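(* Let $G$ be a finitely generated virtually free group and let $\varphi\in \mathrm{End}(G)$ be defined by the images of the generators. It is decidable (there is an algorithm which, given $G$ and $\varphi$, decides) whether $\varphi$ is a finite order element of $\mathrm{End}(G)$ or not. It is also decidable whether $\varphi$ is aperiodic or not.
   Context: $\varphi\in\mathrm{End}(G)$ has finite order if there are natural numbers $p\neq q$ such that $\varphi^p=\varphi^q$. $\varphi$ is aperiodic if there is a natural number $m$ such that $\varphi^m=\varphi^{m+1}$. Input convention: a finitely generated virtually free group $G$ is given as input by a decomposition as a disjoint union $G=Fb_1\cup\cdots\cup Fb_m$, where $F=F_A\trianglelefteq G$ is a free group on a finite set $A$, together with a presentation $\langle A,b_1,\ldots,b_m\mid R\rangle$ of $G$ in which the relations in $R$ are of the form $b_ia=u_{ia}b_i$ and $b_ib_j=v_{ij}b_{r_{ij}}$, with $u_{ia},v_{ij}\in F_A$, $r_{ij}\in\{1,\ldots,m\}$ (maps such as $\varphi$ are written on the right). *)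

(* Defs.v *)
From HB Require Import structures.
From mathcomp Require Import all_boot.

Set Implicit Arguments.
Unset Strict Implicit.
Unset Printing Implicit Defensive.

(* Algorithms: Kleene's partial recursive (mu-recursive) functions, as a      *)
(* syntax of programs with a big-step semantics.  [computes f xs y] means     *)
(* that [f] halts on the arguments [xs] with output [y].                      *)

Inductive recfun : Type :=
  | RZero
  | RSucc
  | RProj of nat
  | RComp of recfun & seq recfun
  | RPrec of recfun & recfun
  | RMin of recfun.

Inductive computes : recfun -> seq nat -> nat -> Prop :=
  | C_zero xs : computes RZero xs 0
  | C_succ x xs : computes RSucc (x :: xs) x.+1
  | C_proj i xs : i < size xs -> computes (RProj i) xs (nth 0 xs i)
  | C_comp f gs xs ys z :
      computes_seq gs xs ys -> computes f ys z -> computes (RComp f gs) xs z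
  | C_prec0 f g xs y : computes f xs y -> computes (RPrec f g) (0 :: xs) y
  | C_precS f g n xs y z :
      computes (RPrec f g) (n :: xs) y -> computes g (n :: y :: xs) z ->
      computes (RPrec f g) (n.+1 :: xs) z
  | C_min f xs n :
      (forall k, k < n -> exists y, computes f (k :: xs) y.+1) ->
      computes f (n :: xs) 0 -> computes (RMin f) xs n
with computes_seq : seq recfun -> seq nat -> seq nat -> Prop :=
  | C_nil xs : computes_seq [::] xs [::]
  | C_cons g gs xs y ys :
      computes g xs y -> computes_seq gs xs ys ->
      computes_seq (g :: gs) xs (y :: ys).

Definition decides (M : recfun) (x : nat) (P : Prop) : Prop :=
  (P -> computes M [:: x] 1) /\ (~ P -> computes M [:: x] 0).

(* Group words: the letter [(x, false)] stands for x, [(x, true)] for x^-1.   *)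

Definition word (X : Type) := seq (X * bool).

Definition weval (X : Type) (G : groupType) (g : X -> G) (w : word X) : G :=
  (\prod_(l <- w) (if l.2 then (g l.1)^-1 else g l.1))%g.

Definition reduced (X : eqType) (w : word X) : bool :=
  sorted (fun l l' => l' != (l.1, ~~ l.2)) w.

(* [wcongr R] is equality of words in the group presented by < X | R >, where *)
(* [R w w'] is the defining relation w = w'.                                  *)
Inductive wcongr (X : Type) (R : word X -> word X -> Prop) :
    word X -> word X -> Prop :=
  | WC_rel w w' : R w w' -> wcongr R w w'
  | WC_cancel x e : wcongr R [:: (x, e); (x, ~~ e)] [::]
  | WC_cat w1 w1' w2 w2' :
      wcongr R w1 w1' -> wcongr R w2 w2' -> wcongr R (w1 ++ w2) (w1' ++ w2')
  | WC_refl w : wcongr R w w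
  | WC_sym w w' : wcongr R w w' -> wcongr R w' w
  | WC_trans w w' w'' : wcongr R w w' -> wcongr R w' w'' -> wcongr R w w''.

Definition presented_by (X : Type) (R : word X -> word X -> Prop)
    (G : groupType) (g : X -> G) : Prop :=
  (forall h : G, exists w, weval g w = h) /\
  (forall w w', weval g w = weval g w' <-> wcongr R w w').

(* Input data for the group: A is 'I_dA, the coset representatives            *)
(* b_1, ..., b_m are indexed by 'I_dm, and the relations are                  *)
(*   b_i a = u_ia b_i   and   b_i b_j = v_ij b_(r_ij).                        *)
Record vfdata := VFData {
  dA : nat;
  dm : nat;
  du : 'I_dm -> 'I_dA -> word 'I_dA;
  dv : 'I_dm -> 'I_dm -> word 'I_dA;
  dr : 'I_dm -> 'I_dm -> 'I_dm
}.

Definition vfgen (D : vfdata) : Type := ('I_(dA D) + 'I_(dm D))%type.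

Section Decomposition.
Variable D : vfdata.

Definition ltrA (a : 'I_(dA D)) : vfgen D * bool := (inl a, false).
Definition ltrB (i : 'I_(dm D)) : vfgen D * bool := (inr i, false).
Definition wordA (w : word 'I_(dA D)) : word (vfgen D) :=
  [seq (inl l.1, l.2) | l <- w].

Inductive vfrel : word (vfgen D) -> word (vfgen D) -> Prop :=
  | VFR_conj i a : vfrel [:: ltrB i; ltrA a] (wordA (du i a) ++ [:: ltrB i])
  | VFR_mul i j :
      vfrel [:: ltrB i; ltrB j] (wordA (dv i j) ++ [:: ltrB (dr i j)]).

Variables (G : groupType) (g : vfgen D -> G).

Definition in_F (h : G) : Prop :=
  exists w : word 'I_(dA D), h = weval (fun a => g (inl a)) w.

(* G, with the generators g, is given by the data D: F = F_A is free on A and *)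
(* normal in G, G is the disjoint union of the F b_i, and G = < A, b | R >.   *)
Record vf_decomposition : Prop := VFDecomposition {
  vf_free : forall w w' : word 'I_(dA D), reduced w -> reduced w' ->
    weval (fun a => g (inl a)) w = weval (fun a => g (inl a)) w' -> w = w';
  vf_normal : forall f h : G, in_F f -> in_F (f ^ h)%g;
  vf_cover : forall h : G, exists i f, in_F f /\ h = (f * g (inr i))%g;
  vf_disjoint : forall i j f f', in_F f -> in_F f' ->
    (f * g (inr i))%g = (f' * g (inr j))%g -> i = j;
  vf_presented : presented_by vfrel g
}.

End Decomposition.

(* Encoding of the input as a natural number, through the bijection           *)
(* [CodeSeq.code : seq nat -> nat]; the generators are numbered               *)
(* A first, then b_1, ..., b_m.                                               *)

Definition code_word (X : Type) (e : X -> nat) (w : word X) : nat :=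
  CodeSeq.code [seq (e l.1).*2 + nat_of_bool l.2 | l : X * bool <- w].

Definition code_gen (D : vfdata) (x : vfgen D) : nat :=
  match x with inl a => nat_of_ord a | inr i => dA D + i end.

Definition code_input (D : vfdata) (img : vfgen D -> word (vfgen D)) : nat :=
  let A := enum 'I_(dA D) in
  let B := enum 'I_(dm D) in
  CodeSeq.code [::
    dA D;
    dm D;
    CodeSeq.code [seq code_word val (du i a) | i <- B, a <- A];
    CodeSeq.code [seq code_word val (dv i j) | i <- B, j <- B];
    CodeSeq.code [seq val (dr i j) | i <- B, j <- B];
    CodeSeq.code [seq code_word (@code_gen D) (img (inl a)) | a <- A];
    CodeSeq.code [seq code_word (@code_gen D) (img (inr i)) | i <- B]].

Definition finite_order (G : groupType) (phi : {multiplicative G -> G}) : Prop :=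
  exists p q : nat, p <> q /\ iter p phi =1 iter q phi.

Definition aperiodic (G : groupType) (phi : {multiplicative G -> G}) : Prop :=
  exists m : nat, iter m phi =1 iter m.+1 phi.

(* Main.v *)
(* Idea. Let V be the intersection of the kernels of all homomorphisms from G
   to the symmetric group on the m cosets of F. It is fully invariant, of
   computably bounded finite index, and contained in F. The images phi^k(V)
   are free, with bases given by Schreier transversals; their ranks decrease,
   and when two consecutive ranks agree, phi is injective on phi^k(V), because
   counting homomorphisms to finite groups shows that every such homomorphism
   factors through phi, and free groups are residually finite. Hence the
   preperiod of phi is bounded. If phi has finite order, then for a computable
   C the map psi = phi^(C!) is an automorphism of finite order of
   W = phi^C(V) acting trivially on Hom(W, Z) modulo 6, by the pigeonhole
   principle on Hom(V, Z/6). As in Minkowski's lemma, psi then acts trivially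
   on Hom(W, Z), therefore on all Magnus coefficients of elements of W by
   induction on their length, so psi is the identity on W. For h in phi^C(G),
   psi(h) = v h with v in W fixed by psi, so v has finite order and v = 1.
   Thus phi has finite order if and only if phi^C = phi^(C + C!), and it is
   aperiodic if and only if phi^C = phi^(C+1); both equations are decided with
   normal forms w b_i. *)

Require Import Defs.
From HB Require Import structures.
From mathcomp Require Import all_boot all_order all_algebra all_fingroup.
From mathcomp Require Import boolp zify ring.

Set Implicit Arguments.
Unset Strict Implicit.
Unset Printing Implicit Defensive.

(** * Computable functions *)

(** The exponents to be compared depend only on the numbers |A| and m, so the machine merely tests
    one equation on the generators: V, the images phi^k(V) and their bases are never computed and
    can be handled as classical predicates. V replaces F because phi need not map F into F. The
    three summands of C pay for three counts. The index of V bounds the time after which the cosets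
    of V recur along an orbit; the index times |A| bounds the rank of V, hence the number of times a
    rank can drop; 6 raised to that product bounds the number of homomorphisms from V to Z/6. Each
    period obtained from a pigeonhole is at most C and so divides C!. The modulus 6 = 2 * 3 is taken
    because for every prime r one of 2 and 3 is coprime to r; Minkowski's argument then becomes a
    descent along the powers of that prime. The step on equal ranks is the Hopfian property of free
    groups of finite rank: a rank is seen through the number of homomorphisms to a finite group, and
    a surjection can only lower that number. *)

Definition nrec (f : seq nat -> nat) k := exists M, forall xs, size xs = k ->
  computes M xs (f xs).

Lemma nrec_ext k f f' : nrec f k -> (forall xs, size xs = k -> f xs = f' xs) ->
  nrec f' k.
Proof. by move=> [M Mf] e; exists M => xs sx; rewrite -e //; apply: Mf. Qed.

Lemma nrec_proj k i : i < k -> nrec (fun xs => nth 0 xs i) k.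
Proof. by move=> ik; exists (RProj i) => xs sx; constructor; rewrite sx. Qed.

Lemma nrec_zero k : nrec (fun=> 0) k.
Proof. by exists RZero => xs _; constructor. Qed.

Lemma nrec_comp1 k f g : nrec f 1 -> nrec g k -> nrec (fun xs => f [:: g xs]) k.
Proof.
move=> [M Mf] [N Ng]; exists (RComp M [:: N]) => xs sx.
by apply: C_comp (Mf _ _) => //; repeat constructor; apply: Ng.
Qed.

Lemma nrec_comp2 k f g h : nrec f 2 -> nrec g k -> nrec h k ->
  nrec (fun xs => f [:: g xs; h xs]) k.
Proof.
move=> [M Mf] [N Ng] [P Ph]; exists (RComp M [:: N; P]) => xs sx.
by apply: C_comp (Mf _ _) => //; repeat constructor; [apply: Ng|apply: Ph].
Qed.

Lemma nrec_succ k f : nrec f k -> nrec (fun xs => (f xs).+1) k.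
Proof.
move=> Mf; apply: (@nrec_comp1 _ (fun xs => (head 0 xs).+1)) Mf.
by exists RSucc => -[|x []] //= _; constructor.
Qed.

Lemma nrec_prec k f g : nrec f k -> nrec g k.+2 ->
  nrec (fun xs => nat_rec (fun=> nat) (f (behead xs))
    (fun n y => g (n :: y :: behead xs)) (head 0 xs)) k.+1.
Proof.
move=> [M Mf] [N Ng]; exists (RPrec M N) => -[|n xs] //= [sx].
elim: n => [|n IH] /=; first by constructor; apply: Mf.
by apply: C_precS IH (Ng _ _); rewrite /= sx.
Qed.

Lemma nrec_min k f (F : seq nat -> nat) : nrec f k.+1 ->
  (forall xs, size xs = k ->
    f (F xs :: xs) = 0 /\ forall m, m < F xs -> f (m :: xs) <> 0) ->
  nrec F k.
Proof.
move=> [M Mf] FE; exists (RMin M) => xs sx; have [F0 Flt] := FE xs sx.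
constructor=> [m /Flt|]; last by rewrite -F0; apply: Mf; rewrite /= sx.
case E: (f (m :: xs)) => [|y] // _; exists y; rewrite -E.
by apply: Mf; rewrite /= sx.
Qed.

Lemma nrec_add : nrec (fun xs => nth 0 xs 0 + nth 0 xs 1) 2.
Proof.
apply: (nrec_ext (nrec_prec (@nrec_proj 1 0 isT) (nrec_succ (@nrec_proj 3 1 isT)))).
by move=> [|x [|y []]] //= _; elim: x => //= x ->.
Qed.

Lemma nrec_mul : nrec (fun xs => nth 0 xs 0 * nth 0 xs 1) 2.
Proof.
apply: (nrec_ext (nrec_prec (nrec_zero 1)
  (nrec_comp2 nrec_add (@nrec_proj 3 2 isT) (@nrec_proj 3 1 isT)))).
by move=> [|x [|y []]] //= _; elim: x => //= x ->.
Qed.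

Lemma nrec_pred : nrec (fun xs => (nth 0 xs 0).-1) 1.
Proof.
apply: (nrec_ext (nrec_prec (nrec_zero 0) (@nrec_proj 2 0 isT))).
by move=> [|[|x] []].
Qed.

Lemma nrec_sub : nrec (fun xs => nth 0 xs 0 - nth 0 xs 1) 2.
Proof.
have h := nrec_prec (@nrec_proj 1 0 isT) (nrec_comp1 nrec_pred (@nrec_proj 3 1 isT)).
apply: (nrec_ext (nrec_comp2 h (@nrec_proj 2 1 isT) (@nrec_proj 2 0 isT))).
by move=> [|x [|y []]] //= _; elim: y => [|y /= ->]; rewrite ?subn0 ?subnS.
Qed.

Lemma nrec_exp : nrec (fun xs => nth 0 xs 0 ^ nth 0 xs 1) 2.
Proof.
have h := nrec_prec (nrec_succ (nrec_zero 1))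
  (nrec_comp2 nrec_mul (@nrec_proj 3 2 isT) (@nrec_proj 3 1 isT)).
apply: (nrec_ext (nrec_comp2 h (@nrec_proj 2 1 isT) (@nrec_proj 2 0 isT))).
by move=> [|x [|y []]] //= _; elim: y => [|y /= ->] //; rewrite expnS.
Qed.

Lemma nrec_odd : nrec (fun xs => odd (nth 0 xs 0)) 1.
Proof.
have h := nrec_prec (nrec_zero 0)
  (nrec_comp2 nrec_sub (nrec_succ (nrec_zero 2)) (@nrec_proj 2 1 isT)).
by apply: (nrec_ext h) => -[|x []] //= _; elim: x => //= x ->; case: (odd x).
Qed.

(** Minimization: the quotient is the least [q] with [x < q.+1 * 2 ^ y], a test that truncated
    subtraction turns into a zero. Powers of 2 are the only divisors needed, to undo [cpair] and to
    halve. *)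
Lemma nrec_div2n : nrec (fun xs => nth 0 xs 0 %/ 2 ^ nth 0 xs 1) 2.
Proof.
have h2 : nrec (fun xs => 2 ^ nth 0 xs 2) 3.
  exact: (nrec_comp2 nrec_exp (nrec_succ (nrec_succ (nrec_zero 3))) (@nrec_proj 3 2 isT)).
have h := nrec_comp2 nrec_sub (nrec_succ (@nrec_proj 3 1 isT))
  (nrec_comp2 nrec_mul (nrec_succ (@nrec_proj 3 0 isT)) h2).
apply: (nrec_min h) => -[|x [|y []]] //= _.
have p0 : 0 < 2 ^ y by rewrite expn_gt0.
split; first by apply/eqP; rewrite subn_eq0; apply: ltn_ceil.
by move=> m; rewrite leq_divRL // => lt /eqP; rewrite subn_eq0 ltnNge lt.
Qed.

(** One step of [CodeSeq.code]: the code of [x :: s] is [cpair x] applied to the code of [s], and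
    the empty list has code 0. The same pairing therefore serves products and the decomposition of
    lists. *)
Definition cpair a b := 2 ^ a * b.*2.+1.
Definition cfst z := logn 2 z.
Definition csnd z := (z %/ 2 ^ cfst z) %/ 2.

Lemma logn2_cpair a b : logn 2 (cpair a b) = a.
Proof.
rewrite /cpair lognM ?expn_gt0 // pfactorK // lognE /= dvdn2 /= odd_double.
by rewrite addn0.
Qed.

Lemma cfstE a b : cfst (cpair a b) = a. Proof. exact: logn2_cpair. Qed.

Lemma csndE a b : csnd (cpair a b) = b.
Proof.
by rewrite /csnd cfstE /cpair mulKn ?expn_gt0 // divn2 /= uphalf_double.
Qed.

Lemma cpair_gt0 a b : 0 < cpair a b.
Proof. by rewrite /cpair muln_gt0 expn_gt0. Qed.

Lemma nrec_cpair : nrec (fun xs => cpair (nth 0 xs 0) (nth 0 xs 1)) 2.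
Proof.
have h2 : nrec (fun xs => 2 ^ nth 0 xs 0) 2.
  exact: (nrec_comp2 nrec_exp (nrec_succ (nrec_succ (nrec_zero 2))) (@nrec_proj 2 0 isT)).
apply: (nrec_ext (nrec_comp2 nrec_mul h2 (nrec_succ
  (nrec_comp2 nrec_add (@nrec_proj 2 1 isT) (@nrec_proj 2 1 isT))))).
by move=> [|x [|y []]] //= _; rewrite addnn.
Qed.

Lemma nrec_cfst : nrec (fun xs => cfst (nth 0 xs 0)) 1.
Proof.
(* The valuation is the least [k] with [z %/ 2 ^ k] odd; the factor [z] stops the search at once for
   [z = 0], where [logn] is 0. *)
have h := nrec_comp2 nrec_mul (@nrec_proj 2 1 isT) (nrec_comp2 nrec_sub
  (nrec_succ (nrec_zero 2)) (nrec_comp1 nrec_odd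
    (nrec_comp2 nrec_div2n (@nrec_proj 2 1 isT) (@nrec_proj 2 0 isT)))).
apply: (nrec_min h) => -[|z []] //= _; rewrite /cfst.
case: z => [|z]; first by rewrite logn0.
have [|m co zE] := @pfactor_coprime 2 z.+1 isT; first by [].
have om : odd m by rewrite coprime2n in co.
have p0 k : 0 < 2 ^ k by rewrite expn_gt0.
split=> [|k klt]; first by rewrite {2}zE mulnK // om muln0.
have -> : z.+1 %/ 2 ^ k = m * 2 ^ (logn 2 z.+1 - k).
  by rewrite {1}zE -{1}(subnK (ltnW klt)) expnD mulnA mulnK.
rewrite oddM oddX.
have -> : (logn 2 z.+1 - k == 0) = false by lia.
by rewrite andbF muln1 /=; have := p0 k; lia.
Qed.

Lemma nrec_csnd : nrec (fun xs => csnd (nth 0 xs 0)) 1.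
Proof.
have h := nrec_comp2 nrec_div2n (nrec_comp2 nrec_div2n
  (@nrec_proj 1 0 isT) (nrec_comp1 nrec_cfst (@nrec_proj 1 0 isT)))
  (nrec_succ (nrec_zero 1)).
exact: h.
Qed.

(** * Computable functions between encoded types *)

Class Enc (A : Type) := enc : A -> nat.
#[global] Hint Mode Enc ! : typeclass_instances.

#[global] Instance enc_nat : Enc nat := id.
#[global] Instance enc_bool : Enc bool := nat_of_bool.
#[global] Instance enc_prod (A B : Type) (EA : Enc A) (EB : Enc B) : Enc (A * B) :=
  fun p => cpair (enc p.1) (enc p.2).
#[global] Instance enc_seq (A : Type) (EA : Enc A) : Enc (seq A) :=
  fun s => CodeSeq.code (map enc s).

(** Unary on purpose: several arguments are functions of one parameter in [A], and the closure rules
    for recursion, cases and folds pass that parameter to their steps inside a pair. *)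
Definition computable (A B : Type) (EA : Enc A) (EB : Enc B) (f : A -> B) :=
  exists M, forall a, computes M [:: enc a] (enc (f a)).
Arguments computable {A B EA EB} f.

Section Computable.
Context {A B C : Type} {EA : Enc A} {EB : Enc B} {EC : Enc C}.

Lemma cp_id : computable (fun a : A => a).
Proof. by exists (RProj 0) => a; apply: (@C_proj 0 [:: enc a]). Qed.

Lemma cp_comp (f : A -> B) (g : B -> C) :
  computable f -> computable g -> computable (fun a => g (f a)).
Proof.
move=> [M Mf] [N Ng]; exists (RComp N [:: M]) => a.
by apply: C_comp (Ng _); repeat constructor.
Qed.

Lemma cp_nrec1 (F : seq nat -> nat) (f : A -> nat) : nrec F 1 ->
  computable f -> computable (fun a => F [:: f a]).
Proof.
move=> [N NF] [M Mf]; exists (RComp N [:: M]) => a.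
by apply: C_comp (NF _ _) => //; repeat constructor; apply: Mf.
Qed.

Lemma cp_nrec2 (F : seq nat -> nat) (f g : A -> nat) : nrec F 2 ->
  computable f -> computable g -> computable (fun a => F [:: f a; g a]).
Proof.
move=> [N NF] [M Mf] [P Pg]; exists (RComp N [:: M; P]) => a.
by apply: C_comp (NF _ _) => //; repeat constructor; [apply: Mf|apply: Pg].
Qed.

Lemma cp_enc (f : A -> B) : computable f -> computable (fun a => enc (f a)).
Proof. by move=> [M Mf]; exists M. Qed.

Lemma cp_enc_inv (f : A -> B) : computable (fun a => enc (f a)) -> computable f.
Proof. by move=> [M Mf]; exists M. Qed.

Lemma cp_natconst (n : nat) : computable (fun _ : A => n).
Proof.
have [M Mf] : nrec (fun=> n) 1.
  by elim: n => [|n IH]; [exact: nrec_zero|exact: nrec_succ].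
by exists M => a; apply: (Mf [:: enc a]).
Qed.

Lemma cp_const (b : B) : computable (fun _ : A => b).
Proof. by apply: cp_enc_inv; apply: cp_natconst. Qed.

End Computable.

Section ComputableStructures.
Context {A B C S : Type}.
Context {EA : Enc A} {EB : Enc B} {EC : Enc C} {ES : Enc S}.

Lemma cp_pair (f : A -> B) (g : A -> C) :
  computable f -> computable g -> computable (fun a => (f a, g a)).
Proof.
move=> cf cg; apply: cp_enc_inv.
exact: (cp_nrec2 nrec_cpair (cp_enc cf) (cp_enc cg)).
Qed.

Lemma cp_fst (f : A -> B * C) : computable f -> computable (fun a => (f a).1).
Proof.
move=> cf; apply: cp_enc_inv; have [M Mf] := cp_nrec1 nrec_cfst (cp_enc cf).
by exists M => a; have := Mf a; rewrite [nth _ _ _]/= cfstE.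
Qed.

Lemma cp_snd (f : A -> B * C) : computable f -> computable (fun a => (f a).2).
Proof.
move=> cf; apply: cp_enc_inv; have [M Mf] := cp_nrec1 nrec_csnd (cp_enc cf).
by exists M => a; have := Mf a; rewrite [nth _ _ _]/= csndE.
Qed.

Lemma cp_nat_rect (f : A -> S) (k : A -> nat) (g : A -> nat -> S -> S) :
  computable f -> computable k ->
  computable (fun p : A * (nat * S) => g p.1 p.2.1 p.2.2) ->
  computable (fun a => nat_rect (fun=> S) (f a) (g a) (k a)).
Proof.
move=> [M Mf] [N Nk] [P Pg].
have [Q Qpair] := nrec_cpair.
exists (RComp (RPrec M (RComp P [:: RComp Q [:: RProj 2; RComp Q [:: RProj 0; RProj 1]]]))
  [:: N; RProj 0]) => a.
apply: C_comp.
  by apply: C_cons (Nk a) _; apply: C_cons (C_nil _); apply: (@C_proj 0 [:: enc a]).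
rewrite -[enc (k a)]/(k a); elim: (k a) => [|n IH] /=; first by constructor.
apply: C_precS IH _; set y := nat_rect _ _ _ _.
apply: C_comp (Pg (a, (n, y))); repeat constructor.
apply: C_comp (Qpair [:: enc a; cpair n (enc y)] erefl).
apply: C_cons; first exact: (@C_proj 2 [:: n; enc y; enc a]).
apply: C_cons (C_nil _); apply: C_comp (Qpair [:: n; enc y] erefl).
apply: C_cons; first exact: (@C_proj 0 [:: n; enc y; enc a]).
by apply: C_cons (C_nil _); exact: (@C_proj 1 [:: n; enc y; enc a]).
Qed.

(** A primitive recursion whose number of rounds is the sign of the code of the list, 0 or 1. In the
    nonempty case the code of [x :: s] is already the code of the pair [(x, s)]. *)
Lemma cp_case (l : A -> seq B) (f : A -> S) (g : A -> B -> seq B -> S) :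
  computable l -> computable f ->
  computable (fun p : A * (B * seq B) => g p.1 p.2.1 p.2.2) ->
  computable (fun a => if l a is x :: s then g a x s else f a).
Proof.
move=> [N Nl] [M Mf] [P Pg]; have [Q Qpair] := nrec_cpair.
have [R Rsg] : nrec (fun xs => 1 - (1 - nth 0 xs 0)) 1.
  exact: (nrec_comp2 nrec_sub (nrec_succ (nrec_zero 1))
    (nrec_comp2 nrec_sub (nrec_succ (nrec_zero 1)) (@nrec_proj 1 0 isT))).
exists (RComp (RPrec (RComp M [:: RProj 0]) (RComp P [:: RComp Q [:: RProj 2; RProj 3]]))
  [:: RComp R [:: N]; RProj 0; N]) => a.
apply: C_comp.
  apply: C_cons; first by apply: C_comp (Rsg [:: enc (l a)] erefl); repeat constructor.
  apply: C_cons; first exact: (@C_proj 0 [:: enc a]).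
  by apply: C_cons (Nl a) (C_nil _).
have Mf' : computes (RComp M [:: RProj 0]) [:: enc a; enc (l a)] (enc (f a)).
  apply: C_comp (Mf a); apply: C_cons (C_nil _).
  exact: (@C_proj 0 [:: enc a; enc (l a)]).
case el: (l a) Mf' => [|x s] Mf' /=; first by constructor.
have -> : 1 - (1 - @enc _ (enc_seq EB) (x :: s)) = 1.
  by have gt0 : 0 < @enc _ (enc_seq EB) (x :: s) := cpair_gt0 _ _; lia.
apply: C_precS (C_prec0 _ Mf') _.
apply: C_comp (Pg (a, (x, s))); apply: C_cons (C_nil _).
apply: C_comp (Qpair [:: enc a; @enc _ (enc_seq EB) (x :: s)] erefl).
apply: C_cons; first exact: (@C_proj 2 [:: 0; enc (f a); enc a; @enc _ (enc_seq EB) (x :: s)]).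
by apply: C_cons (C_nil _); exact: (@C_proj 3 [:: 0; enc (f a); enc a; @enc _ (enc_seq EB) (x :: s)]).
Qed.

Lemma cp_cons (f : A -> B) (s : A -> seq B) :
  computable f -> computable s -> computable (fun a => f a :: s a).
Proof.
move=> cf cs; apply: cp_enc_inv.
exact: (cp_nrec2 nrec_cpair (cp_enc cf) (cp_enc cs)).
Qed.

End ComputableStructures.

Lemma computable_ext (A B : Type) (EA : Enc A) (EB : Enc B) (f f' : A -> B) :
  computable f -> f =1 f' -> computable f'.
Proof. by move=> [M Mf] e; exists M => a; rewrite -e. Qed.

Section Arithmetic.
Context {A : Type} {EA : Enc A}.
Implicit Types f g : A -> nat.

Lemma cp_succ f : computable f -> computable (fun a => (f a).+1).
Proof. exact: (cp_nrec1 (nrec_succ (@nrec_proj 1 0 isT))). Qed.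

Lemma cp_pred f : computable f -> computable (fun a => (f a).-1).
Proof. exact: (cp_nrec1 nrec_pred). Qed.

Lemma cp_add f g : computable f -> computable g -> computable (fun a => f a + g a).
Proof. exact: (cp_nrec2 nrec_add). Qed.

Lemma cp_sub f g : computable f -> computable g -> computable (fun a => f a - g a).
Proof. exact: (cp_nrec2 nrec_sub). Qed.

Lemma cp_mul f g : computable f -> computable g -> computable (fun a => f a * g a).
Proof. exact: (cp_nrec2 nrec_mul). Qed.

Lemma cp_exp f g : computable f -> computable g -> computable (fun a => f a ^ g a).
Proof. exact: (cp_nrec2 nrec_exp). Qed.

Lemma cp_odd f : computable f -> computable (fun a => odd (f a)).
Proof. by move=> cf; apply: cp_enc_inv; apply: (cp_nrec1 nrec_odd). Qed.

Lemma cp_half f : computable f -> computable (fun a => (f a)./2).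
Proof.
move=> cf; have c1 : computable (fun _ : A => 1) by apply: cp_const.
by apply: (computable_ext (cp_nrec2 nrec_div2n cf c1)) => a /=; rewrite expn1 divn2.
Qed.

Lemma cp_leq f g : computable f -> computable g -> computable (fun a => f a <= g a).
Proof.
move=> cf cg; apply: cp_enc_inv.
apply: (computable_ext (cp_sub (cp_const (A := A) 1) (cp_sub cf cg))) => a.
by rewrite /leq; case: (f a - g a).
Qed.

Lemma cp_decode f : computable f -> computable (fun a => CodeSeq.decode (f a)).
Proof.
move=> cf; apply: cp_enc_inv; apply: (computable_ext cf) => a.
by rewrite /enc /enc_seq map_id CodeSeq.decodeK.
Qed.

End Arithmetic.

Ltac cp_struct := lazymatch goal with
  | |- @computable _ _ _ _ (fun p => p) => exact cp_id
  | |- @computable _ _ _ _ (fun _ => ?c) => exact (cp_const c)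
  | |- @computable _ _ _ _ (fun p => (@?f p, @?g p)) =>
      refine (cp_pair (f := f) (g := g) _ _); cp_struct
  | |- @computable _ _ _ _ (fun p => fst (@?f p)) =>
      refine (cp_fst (f := f) _); cp_struct
  | |- @computable _ _ _ _ (fun p => snd (@?f p)) =>
      refine (cp_snd (f := f) _); cp_struct
  | |- @computable _ _ _ _ (fun p => cons (@?f p) (@?g p)) =>
      refine (cp_cons (f := f) (s := g) _ _); cp_struct
  | _ => try assumption
  end.

Section Control.
Context {A S : Type} {EA : Enc A} {ES : Enc S}.

Lemma cp_if (b : A -> bool) (f g : A -> S) : computable b -> computable f ->
  computable g -> computable (fun a => if b a then f a else g a).
Proof.
move=> cb cf cg.
have h : computable (fun p : A * (nat * S) => f p.1).
  by apply: (cp_comp (f := fun p : A * (nat * S) => p.1) _ cf); cp_struct.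
apply: (computable_ext (cp_nat_rect (g := fun a _ _ => f a) cg (cp_enc cb) h)) => a.
by case: (b a).
Qed.

Lemma cp_andb (b c : A -> bool) : computable b -> computable c ->
  computable (fun a => b a && c a).
Proof.
move=> cb cc; apply: cp_enc_inv; apply: (computable_ext (cp_mul (cp_enc cb) (cp_enc cc))) => a.
by case: (b a); case: (c a).
Qed.

Lemma cp_eqn (f g : A -> nat) : computable f -> computable g ->
  computable (fun a => f a == g a).
Proof.
move=> cf cg; apply: (computable_ext (cp_andb (cp_leq cf cg) (cp_leq cg cf))) => a.
by rewrite eqn_leq.
Qed.

Lemma cp_iter (n : A -> nat) (x : A -> S) (f : A -> S -> S) :
  computable n -> computable x -> computable (fun p : A * S => f p.1 p.2) ->
  computable (fun a => iter (n a) (f a) (x a)).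
Proof.
move=> cn cx cf.
have h : computable (fun p : A * (nat * S) => f p.1 p.2.2).
  by apply: (cp_comp (f := fun p : A * (nat * S) => (p.1, p.2.2)) _ cf); cp_struct.
apply: (computable_ext (cp_nat_rect (g := fun a _ => f a) cx cn h)) => a.
by elim: (n a) => //= k ->.
Qed.

End Control.

Section Folds.
Context {A B S : Type} {EA : Enc A} {EB : Enc B} {ES : Enc S}.

Lemma enc_seq_size (l : seq B) : size l <= enc l.
Proof.
elim: l => //= x l IH; apply: leq_ltn_trans IH _.
rewrite -[X in _ < X]/(cpair (enc x) (@enc _ (enc_seq EB) l)) /cpair.
have : 0 < 2 ^ enc x by rewrite expn_gt0.
by move: (2 ^ _) (@enc _ _ l) => p k; nia.
Qed.

(** The fold is iterated on pairs of an accumulator and a remaining list, for [enc (l a)] rounds.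
    This is at least the length, and the surplus rounds are idle since [step] fixes a pair whose
    list is empty. *)
Lemma cp_foldl (l : A -> seq B) (x : A -> S) (f : A -> S -> B -> S) :
  computable l -> computable x ->
  computable (fun p : A * (S * B) => f p.1 p.2.1 p.2.2) ->
  computable (fun a => foldl (f a) (x a) (l a)).
Proof.
move=> cl cx cf.
pose step a (st : S * seq B) := if st.2 is y :: s then (f a st.1 y, s) else st.
have cstep :
  computable (fun p : A * (S * seq B) => step p.1 p.2).
  apply: (@cp_case _ _ _ _ _ _ (fun p : A * (S * seq B) => p.2.2) (fun p => p.2)
    (fun p y s => (f p.1 p.2.1 y, s))); cp_struct.
  by apply: (cp_comp (f := fun p : (A * (S * seq B)) * (B * seq B) =>
    (p.1.1, (p.1.2.1, p.2.1))) _ cf); cp_struct.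
have h := cp_iter (f := step) (cp_enc cl) (cp_pair cx cl) cstep.
refine (computable_ext (cp_fst h) _) => a.
have : size (l a) <= enc (l a) by apply: enc_seq_size.
move: (enc (l a)) => n; elim: n (l a) (x a) => [|n IH] [|y s] z //= sz.
  by have -> : iter n (step a) (z, [::]) = (z, [::]) by elim: (n) => //= k ->.
by rewrite -IH // -iterS iterSr.
Qed.

End Folds.

Section Lists.
Context {A B : Type} {EA : Enc A} {EB : Enc B}.

Lemma cp_rev (l : A -> seq B) : computable l -> computable (fun a => rev (l a)).
Proof.
move=> cl; have h : computable (fun p : A * (seq B * B) => p.2.2 :: p.2.1) by cp_struct.
apply: (computable_ext (cp_foldl (x := fun=> [::]) (f := fun _ s y => y :: s) cl (cp_const _) h)).
by move=> a; rewrite -{1}[l a]revK foldl_rev; elim: (rev (l a)) => //= y s ->.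
Qed.

Lemma cp_cat (l s : A -> seq B) : computable l -> computable s ->
  computable (fun a => l a ++ s a).
Proof.
move=> cl cs; have h : computable (fun p : A * (seq B * B) => p.2.2 :: p.2.1) by cp_struct.
apply: (computable_ext (cp_foldl (f := fun _ s y => y :: s) (cp_rev cl) cs h)) => a.
by rewrite foldl_rev; elim: (l a) => //= x t ->.
Qed.

Lemma cp_nth (x : B) (l : A -> seq B) (n : A -> nat) : computable l ->
  computable n -> computable (fun a => nth x (l a) (n a)).
Proof.
move=> cl cn.
have cb : computable (fun p : A * seq B => behead p.2).
  apply: (computable_ext (cp_case (l := fun p : A * seq B => p.2) (f := fun=> [::])
    (g := fun _ _ s => s) _ _ _)) => [|||[a []] //]; cp_struct.
have ci := cp_iter (f := fun _ => behead) cn cl cb.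
apply: (computable_ext (cp_case (f := fun=> x) (g := fun _ y _ => y) ci _ _)) => [||a]; cp_struct.
rewrite -drop_behead -[n a]addn0 -nth_drop addn0.
by case: (drop _ _).
Qed.

End Lists.

(** * The word problem and powers of an endomorphism *)

(** As in [code_word], the numbers 2x and 2x+1 are the letters of generator x and of its inverse;
    inversion flips the last bit. *)
Definition linvn (c : nat) := if odd c then c.-1 else c.+1.

Definition winvn (w : seq nat) := foldl (fun s c => linvn c :: s) [::] w.

Definition pushn (st : seq nat) (c : nat) :=
  if st is c' :: st' then if c == linvn c' then st' else c :: st else [:: c].

Definition signed (c : nat) (w : seq nat) := if odd c then winvn w else w.

Definition tableu (s : seq nat) k := CodeSeq.decode (nth 0 (CodeSeq.decode (nth 0 s 2)) k).
Definition tablev (s : seq nat) k := CodeSeq.decode (nth 0 (CodeSeq.decode (nth 0 s 3)) k).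
Definition tabler (s : seq nat) k := nth 0 (CodeSeq.decode (nth 0 s 4)) k.
Definition tablei (s : seq nat) t :=
  if t < nth 0 s 0 then CodeSeq.decode (nth 0 (CodeSeq.decode (nth 0 s 5)) t)
  else CodeSeq.decode (nth 0 (CodeSeq.decode (nth 0 s 6)) (t - nth 0 s 0)).

(* The index k with r_(k j) = i. *)
Definition invr (s : seq nat) i j :=
  nat_rect (fun=> nat) 0
    (fun k y => if tabler s (k * nth 0 s 1 + j) == i then k else y) (nth 0 s 1).

(* The state (st, i) stands for the element w b_i, where st is the reversed
   reduced word w; a state is multiplied on the right by a letter, using
   b_i b_j^-1 = v_kj^-1 b_k for r_kj = i. *)
Definition gstep (s : seq nat) (x : seq nat * nat) (c : nat) : seq nat * nat :=
  if c./2 < nth 0 s 0 then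
    (foldl pushn x.1 (signed c (tableu s (x.2 * nth 0 s 0 + c./2))), x.2)
  else if odd c then
    (foldl pushn x.1 (winvn
       (tablev s (invr s x.2 (c./2 - nth 0 s 0) * nth 0 s 1 + (c./2 - nth 0 s 0)))),
     invr s x.2 (c./2 - nth 0 s 0))
  else
    (foldl pushn x.1 (tablev s (x.2 * nth 0 s 1 + (c./2 - nth 0 s 0))),
     tabler s (x.2 * nth 0 s 1 + (c./2 - nth 0 s 0))).

(** The initial state stands for b_0, not for 1, whose normal form would have to be found first. The
    result represents b_0 w, and cancelling b_0 on the left leaves comparisons of words
    unaffected. *)
Definition norm s (w : seq nat) := foldl (gstep s) ([::], 0) w.

Definition subst s (w : seq nat) :=
  foldl (fun acc c => acc ++ signed c (tablei s c./2)) [::] w.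

Definition same_power (s : seq nat) n1 n2 : bool :=
  nat_rect (fun=> bool) true (fun t y =>
    y && (enc (norm s (iter n1 (subst s) [:: t.*2])) ==
          enc (norm s (iter n2 (subst s) [:: t.*2])))) (nth 0 s 0 + nth 0 s 1).


Lemma cp_lift (A B T : Type) (EA : Enc A) (EB : Enc B) (ET : Enc T) (f : A -> T) :
  computable f -> computable (fun p : A * B => f p.1).
Proof. by move=> cf; apply: (cp_comp (f := fun p : A * B => p.1) _ cf); cp_struct. Qed.

Lemma cp_linvn (A : Type) (EA : Enc A) (c : A -> nat) :
  computable c -> computable (fun a => linvn (c a)).
Proof. by move=> cc; apply: cp_if; [exact: cp_odd|exact: cp_pred|exact: cp_succ]. Qed.

Lemma cp_factorial (A : Type) (EA : Enc A) (n : A -> nat) :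
  computable n -> computable (fun a => (n a)`!).
Proof.
move=> cn; have h : computable (fun p : A * (nat * nat) => p.2.1.+1 * p.2.2).
  by apply: cp_mul; [apply: cp_succ|]; cp_struct.
apply: (computable_ext (cp_nat_rect (f := fun=> 1) (g := fun _ k y => k.+1 * y) _ cn h)).
  exact: cp_const.
by move=> a; elim: (n a) => //= k ->; rewrite factS.
Qed.

Lemma cp_winvn (A : Type) (EA : Enc A) (w : A -> seq nat) :
  computable w -> computable (fun a => winvn (w a)).
Proof.
move=> cw; apply: (cp_foldl (f := fun _ s c => linvn c :: s) cw (cp_const _)).
by apply: cp_cons; [apply: cp_linvn|]; cp_struct.
Qed.

Lemma cp_signed (A : Type) (EA : Enc A) (c : A -> nat) (w : A -> seq nat) :
  computable c -> computable w -> computable (fun a => signed (c a) (w a)).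
Proof. by move=> cc cw; apply: cp_if; [exact: cp_odd|exact: cp_winvn|]. Qed.

Lemma cp_pushn (A : Type) (EA : Enc A) (st : A -> seq nat) (c : A -> nat) :
  computable st -> computable c -> computable (fun a => pushn (st a) (c a)).
Proof.
move=> cst cc; refine (computable_ext (cp_case (f := fun a => [:: c a]) (g := fun a c' st' =>
  if c a == linvn c' then st' else c a :: c' :: st') cst _ _) _); [| |by move=> a; case: (st a)].
- by apply: cp_cons => //; apply: cp_const.
- have c1 := cp_lift (enc_prod enc_nat (enc_seq enc_nat)) cc.
  apply: cp_if; [|by cp_struct|by cp_struct].
  by apply: cp_eqn => //; apply: cp_linvn; cp_struct.
Qed.

Lemma cp_pushw (A : Type) (EA : Enc A) (st w : A -> seq nat) :
  computable st -> computable w -> computable (fun a => foldl pushn (st a) (w a)).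
Proof.
move=> cst cw; apply: (cp_foldl (f := fun=> pushn) cw cst).
by apply: cp_pushn; cp_struct.
Qed.

Section ComputableAlgorithm.
Context {A : Type} {EA : Enc A} {s : A -> seq nat}.
Hypothesis cs : computable s.

Lemma cp_field k : computable (fun a => nth 0 (s a) k).
Proof. by apply: cp_nth => //; apply: cp_const. Qed.

Lemma cp_table k (n : A -> nat) : computable n ->
  computable (fun a => nth 0 (CodeSeq.decode (nth 0 (s a) k)) (n a)).
Proof. by move=> cn; apply: cp_nth => //; apply/cp_decode/cp_field. Qed.

Lemma cp_tableu n : computable n -> computable (fun a => tableu (s a) (n a)).
Proof. by move=> cn; apply/cp_decode/cp_table. Qed.

Lemma cp_tablev n : computable n -> computable (fun a => tablev (s a) (n a)).
Proof. by move=> cn; apply/cp_decode/cp_table. Qed.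

Lemma cp_tabler n : computable n -> computable (fun a => tabler (s a) (n a)).
Proof. by move=> cn; apply: cp_table. Qed.

Lemma cp_tablei n : computable n -> computable (fun a => tablei (s a) (n a)).
Proof.
move=> cn; apply: cp_if; first by apply: cp_leq; [exact: cp_succ|exact: cp_field].
  by apply/cp_decode/cp_table.
by apply/cp_decode/cp_table; apply: cp_sub => //; apply: cp_field.
Qed.

End ComputableAlgorithm.

Section ComputableNormalForm.
Context {A : Type} {EA : Enc A} {s : A -> seq nat}.
Hypothesis cs : computable s.

Lemma cp_invr (i j : A -> nat) : computable i -> computable j ->
  computable (fun a => invr (s a) (i a) (j a)).
Proof.
move=> ci cj; apply: (cp_nat_rect (f := fun=> 0) (k := fun a => nth 0 (s a) 1)
  (g := fun a k y => if tabler (s a) (k * nth 0 (s a) 1 + j a) == i a then k else y)).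
- exact: cp_const.
- exact: cp_field.
pose E2 := enc_prod enc_nat enc_nat.
have cs1 := cp_lift E2 cs; have ci1 := cp_lift E2 ci; have cj1 := cp_lift E2 cj.
apply: cp_if; [|by cp_struct|by cp_struct].
apply: cp_eqn => //; apply: (cp_tabler cs1); apply: cp_add => //.
by apply: cp_mul; [cp_struct|exact: (cp_field cs1)].
Qed.

Lemma cp_gstep (x : A -> seq nat * nat) c : computable x -> computable c ->
  computable (fun a => gstep (s a) (x a) (c a)).
Proof.
move=> cx cc; have ch := cp_half cc; have c0 := cp_field cs 0; have c1 := cp_field cs 1.
have cj := cp_sub ch c0; have cx1 := cp_fst cx; have cx2 := cp_snd cx.
apply: cp_if; first by apply: cp_leq => //; apply: cp_succ.
  apply: cp_pair => //; apply: cp_pushw => //; apply: cp_signed => //.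
  by apply: (cp_tableu cs); apply: cp_add => //; apply: cp_mul.
have ci := cp_invr cx2 cj.
apply: cp_if; first exact: cp_odd.
  apply: cp_pair => //; apply: cp_pushw => //; apply: cp_winvn; apply: (cp_tablev cs).
  by apply: cp_add => //; apply: cp_mul.
have ck := cp_add (cp_mul cx2 c1) cj.
apply: cp_pair; last exact: (cp_tabler cs).
by apply: cp_pushw => //; apply: (cp_tablev cs).
Qed.

End ComputableNormalForm.

Lemma cp_norm (A : Type) (EA : Enc A) (s w : A -> seq nat) :
  computable s -> computable w -> computable (fun a => norm (s a) (w a)).
Proof.
move=> cs cw; apply: (cp_foldl (f := fun a x c => gstep (s a) x c) cw (cp_const _)).
have cs1 := cp_lift (enc_prod (enc_prod (enc_seq enc_nat) enc_nat) enc_nat) cs.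
by apply: (cp_gstep cs1); cp_struct.
Qed.

Lemma cp_subst (A : Type) (EA : Enc A) (s w : A -> seq nat) :
  computable s -> computable w -> computable (fun a => subst (s a) (w a)).
Proof.
move=> cs cw; apply: (cp_foldl (f := fun a acc c => acc ++ signed c (tablei (s a) c./2))
  cw (cp_const _)).
have cs1 := cp_lift (enc_prod (enc_seq enc_nat) enc_nat) cs.
apply: cp_cat; first by cp_struct.
apply: cp_signed; first by cp_struct.
by apply: (cp_tablei cs1); apply: cp_half; cp_struct.
Qed.

Lemma cp_same_power (A : Type) (EA : Enc A) (s : A -> seq nat) (n1 n2 : A -> nat) :
  computable s -> computable n1 -> computable n2 ->
  computable (fun a => same_power (s a) (n1 a) (n2 a)).
Proof.
move=> cs c1 c2.
apply: (cp_nat_rect (f := fun=> true) (k := fun a => nth 0 (s a) 0 + nth 0 (s a) 1)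
  (g := fun a t y => y && (enc (norm (s a) (iter (n1 a) (subst (s a)) [:: t.*2])) ==
    enc (norm (s a) (iter (n2 a) (subst (s a)) [:: t.*2]))))).
- exact: cp_const.
- by apply: cp_add; apply: cp_field.
apply: cp_andb; first by cp_struct.
pose E2 := enc_prod enc_nat enc_bool; have cs1 := cp_lift E2 cs.
have ci (n : A -> nat) : computable n -> computable (fun p : A * (nat * bool) =>
    enc (norm (s p.1) (iter (n p.1) (subst (s p.1)) [:: p.2.1.*2]))).
  move=> cn; have cn1 := cp_lift E2 cn; apply: cp_enc; apply: cp_norm => //.
  apply: (cp_iter (f := fun p : A * (nat * bool) => subst (s p.1))).
  - exact: cn1.
  - apply: cp_cons; last exact: cp_const.
    have c : computable (fun p : A * (nat * bool) => p.2.1) by cp_struct.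
    by apply: (computable_ext (cp_add c c)) => p; rewrite addnn.
  have cs2 := cp_lift (enc_seq enc_nat) cs1.
  by apply: (cp_subst cs2); apply: (cp_snd cp_id).
by apply: cp_eqn; apply: ci.
Qed.

(** The number of functions to S_m from the set of all maps of the [dA + dm] generators to S_m. A
    homomorphism G -> S_m is given by such a map, and a coset of V by the values that all these
    homomorphisms take on it. *)
Definition coset_bound (dA dm : nat) : nat := (dm`! ^ (dm`! ^ (dA + dm))).

Definition order_bound (dA dm : nat) : nat :=
  (coset_bound dA dm + coset_bound dA dm * dA + 6 ^ (coset_bound dA dm * dA)).

Lemma cp_order_bound (A : Type) (EA : Enc A) (a m : A -> nat) :
  computable a -> computable m -> computable (fun x => order_bound (a x) (m x)).
Proof.
move=> ca cm; have cb : computable (fun x => coset_bound (a x) (m x)).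
  have cf := cp_factorial cm.
  by apply: cp_exp => //; apply: cp_exp => //; apply: cp_add.
have cba := cp_mul cb ca.
by apply: cp_add; [apply: cp_add|apply: cp_exp => //; apply: cp_const].
Qed.

Definition input_bound (s : seq nat) := order_bound (nth 0 s 0) (nth 0 s 1).

Lemma cp_input_bound (A : Type) (EA : Enc A) (s : A -> seq nat) :
  computable s -> computable (fun a => input_bound (s a)).
Proof. by move=> cs; apply: cp_order_bound; apply: cp_field. Qed.

Lemma computable_finite_order : computable (fun x : nat =>
  same_power (CodeSeq.decode x) (input_bound (CodeSeq.decode x))
    (input_bound (CodeSeq.decode x) + (input_bound (CodeSeq.decode x))`!)).
Proof.
have cd : computable (fun x : nat => CodeSeq.decode x) by apply/cp_decode/cp_id.
have cb := cp_input_bound cd.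
by apply: cp_same_power => //; apply: cp_add => //; apply: cp_factorial.
Qed.

Lemma computable_aperiodic : computable (fun x : nat =>
  same_power (CodeSeq.decode x) (input_bound (CodeSeq.decode x))
    (input_bound (CodeSeq.decode x)).+1).
Proof.
have cd : computable (fun x : nat => CodeSeq.decode x) by apply/cp_decode/cp_id.
have cb := cp_input_bound cd.
by apply: cp_same_power => //; apply: cp_succ.
Qed.

Import GroupScope.

(** * Free groups and Magnus coefficients *)

Section FreeReduction.
Variable X : eqType.
Implicit Types (l : X * bool) (w st : word X).

Definition linv l : X * bool := (l.1, ~~ l.2).

Lemma linvK : involutive linv.
Proof. by case=> a e; rewrite /linv /= negbK. Qed.

Definition push st l := if st is l' :: st' then
  if l == linv l' then st' else l :: st else [:: l].

Definition redr w := foldl push [::] w.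

Lemma reduced_push st l : reduced st -> reduced (push st l).
Proof.
case: st => [|l' st] //= r; case: eqP => [_|/eqP ne]; first exact: path_sorted r.
rewrite /reduced /= r andbT; apply: contra ne => /eqP ->.
by rewrite -[(_, _)]/(linv l) linvK.
Qed.

Lemma reduced_redr w : reduced (redr w).
Proof.
rewrite /redr; have: reduced (Nil (X * bool)) by [].
by elim: w [::] => //= l w IH st r; apply/IH/reduced_push.
Qed.

Lemma reduced_rev w : reduced (rev w) = reduced w.
Proof.
rewrite /reduced rev_sorted; case: w => //= l w.
apply: eq_path => -[a e] [b f] /=.
by congr negb; apply/eqP/eqP => -[-> ->]; rewrite ?negbK.
Qed.

Section Fold.
Variables (S : Type) (step : S -> X * bool -> S).
Hypothesis stepK : forall s l, step (step s l) (linv l) = s.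

Lemma foldl_push st l s :
  foldl step s (rev (push st l)) = step (foldl step s (rev st)) l.
Proof.
case: st => [|l' st] //=; case: eqP => [->|_]; last first.
  by rewrite !rev_cons -!cats1 !foldl_cat.
by rewrite rev_cons -cats1 foldl_cat /= stepK.
Qed.

(** An action of letters in which [linv l] undoes [l] cannot distinguish a word from its reduced
    form. Evaluation in a group, Magnus coefficients and Schreier cocycles all become functions on a
    free group through this principle. *)
Lemma foldl_redr s w : foldl step s w = foldl step s (rev (redr w)).
Proof.
rewrite /redr -{1}[w]cat0s -[X in X ++ _]/(rev [::]).
elim: w [::] => [|l w IH] st; first by rewrite cats0.
by rewrite /= -IH foldl_cat /= -foldl_push -foldl_cat.
Qed.

End Fold.

Section Eval.
Variables (G : groupType) (g : X -> G).

Definition lval l : G := if l.2 then (g l.1)^-1 else g l.1.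

Lemma lval_linv l : lval (linv l) = (lval l)^-1.
Proof. by case: l => a []; rewrite /lval /= ?invgK. Qed.

Lemma weval_nil : weval g [::] = 1.
Proof. exact: big_nil. Qed.

Lemma weval_cons l w : weval g (l :: w) = lval l * weval g w.
Proof. exact: big_cons. Qed.

Lemma weval_cat w w' : weval g (w ++ w') = weval g w * weval g w'.
Proof. exact: big_cat. Qed.

Lemma weval_rcons w l : weval g (rcons w l) = weval g w * lval l.
Proof. by rewrite -cats1 weval_cat weval_cons weval_nil mulg1. Qed.

Lemma weval_foldl x w : foldl (fun y l => y * lval l) x w = x * weval g w.
Proof.
elim: w x => [|l w IH] x /=; first by rewrite weval_nil mulg1.
by rewrite IH weval_cons mulgA.
Qed.

Definition winv w := rev (map linv w).

Lemma weval_winv w : weval g (winv w) = (weval g w)^-1.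
Proof.
elim: w => [|l w IH]; first by rewrite weval_nil invg1.
by rewrite /winv /= rev_cons weval_rcons IH weval_cons invgM lval_linv.
Qed.

Lemma weval_redr w : weval g (rev (redr w)) = weval g w.
Proof.
rewrite -[LHS]mul1g -[RHS]mul1g -!weval_foldl -foldl_redr // => x l.
by rewrite lval_linv mulgK.
Qed.

Definition freely := forall w w', reduced w -> reduced w' ->
  weval g w = weval g w' -> w = w'.

Lemma free_redr w w' : freely -> weval g w = weval g w' -> redr w = redr w'.
Proof.
move=> fr e; apply: (can_inj revK); apply: fr.
- by rewrite reduced_rev reduced_redr.
- by rewrite reduced_rev reduced_redr.
- by rewrite !weval_redr.
Qed.

Lemma free_foldl (S : Type) (step : S -> X * bool -> S) s w w' :
  freely -> (forall s l, step (step s l) (linv l) = s) ->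
  weval g w = weval g w' -> foldl step s w = foldl step s w'.
Proof.
by move=> fr sK e; rewrite (foldl_redr sK) (free_redr fr e) -(foldl_redr sK).
Qed.

Definition gen_by (x : G) := exists w, x = weval g w.

Definition wordof (x : G) : word X :=
  if pselect (gen_by x) is left h then projT1 (cid h) else [::].

Lemma wordofK x : gen_by x -> weval g (wordof x) = x.
Proof. by move=> h; rewrite /wordof; case: pselect => // h'; case: cid. Qed.

Lemma gen_by1 : gen_by 1.
Proof. by exists [::]; rewrite weval_nil. Qed.

Lemma gen_byM x y : gen_by x -> gen_by y -> gen_by (x * y).
Proof. by move=> [w ->] [w' ->]; exists (w ++ w'); rewrite weval_cat. Qed.

Lemma gen_byV x : gen_by x -> gen_by x^-1.
Proof. by move=> [w ->]; exists (winv w); rewrite weval_winv. Qed.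

End Eval.
End FreeReduction.

(** * The Magnus embedding modulo squares of the variables *)

Section Magnus.
Import GRing.Theory Num.Theory.
Local Open Scope ring_scope.
Variable X : eqType.
Implicit Types (s : seq X) (v : seq X -> int) (w : word X).

Definition adj s := sorted (fun x y => x != y) s.

Lemma adj_cons b s : adj (b :: s) = (ohead s != Some b) && adj s.
Proof. by case: s => //= c s; rewrite eq_sym; congr andb. Qed.

Definition sgb (e : bool) : int := if e then -1 else 1.

(* Right multiplication by [1 + X_a] or [1 - X_a] in the ring of integral
   noncommutative power series modulo the relations [X_a^2 = 0]; a monomial
   is indexed by the reversed list of its variables. *)
Definition mstep v (l : X * bool) : seq X -> int := fun s =>
  v s + if s is b :: s' then
          if (b == l.1) && adj s then sgb l.2 * v s' else 0
        else 0.

Definition mag w : seq X -> int := foldl mstep (fun s => (s == [::])%:R) w.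

(** This is where [X_a^2 = 0] enters: it gives (1 + X_a)(1 - X_a) = 1, so that inverse letters are
    binomials too. *)
Lemma mstepK v l : mstep (mstep v l) (linv l) = v.
Proof.
apply: funext => -[|b s]; rewrite /mstep; first by rewrite !addr0.
case: l => a e; rewrite /linv [(_, _).1]/= [(_, _).2]/=.
case: eqP => [->|_]; last by rewrite !addr0.
case ad: (adj _); last by rewrite !addr0.
rewrite [true && true]/=; case: s ad => [|c s] ad.
  by rewrite addr0; case: e; rewrite /sgb /=; ring.
have /negPf-> : c != a by case/andP: ad; rewrite eq_sym.
by rewrite [false && _]/= addr0; case: e; rewrite /sgb /=; ring.
Qed.

Lemma mag_rcons w l : mag (rcons w l) = mstep (mag w) l.
Proof. by rewrite /mag foldl_rcons. Qed.

Lemma mag_nil w : mag w [::] = 1.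
Proof.
elim/last_ind: w => [|w l IH] //; by rewrite mag_rcons /mstep IH addr0.
Qed.

Lemma mag_adj w s : ~~ adj s -> mag w s = 0.
Proof.
move=> ns; elim/last_ind: w => [|w l IH]; first by case: s ns.
by rewrite mag_rcons /mstep IH; case: s ns IH => // b s /negPf-> _; rewrite andbF.
Qed.

(** The product formula for series. Monomials are stored reversed, hence [drop i s] is the left
    factor and [take i s] the right one. *)
Lemma mag_cat w w' s : adj s ->
  mag (w ++ w') s = \sum_(i < (size s).+1) mag w (drop i s) * mag w' (take i s).
Proof.
elim/last_ind: w' s => [|w' l IH] s ads.
  rewrite cats0 big_ord_recl /= drop0 take0 mulr1 big1 ?addr0 // => i _.
  rewrite /bump /=; case: s ads i => [|b s] ads i; first by case: i.
  by rewrite add1n /= mulr0.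
rewrite -rcons_cat !mag_rcons {1}/mstep (IH _ ads).
under [RHS]eq_bigr => i _ do rewrite /mstep mulrDr.
rewrite big_split /=; congr (_ + _).
rewrite big_ord_recl take0 mulr0 add0r.
case: s ads => [|b s] ads; first by rewrite big_ord0.
rewrite ads andbT; have [bl|nb] := eqVneq; last first.
  by rewrite big1 // => i _; rewrite /= (negPf nb) mulr0.
rewrite IH; last exact: path_sorted ads.
rewrite big_distrr; apply: eq_bigr => i _ /=.
rewrite bl eqxx add0n.
have -> : path (fun x y => x != y) l.1 (take i s).
  rewrite -bl; exact: (take_sorted (s := b :: s) i.+1 ads).
by rewrite mulrCA.
Qed.

(** The generators of the syllables, that is, of the maximal blocks in one generator. Here [u] is a
    word read backwards, to match the reversed monomials. *)
Fixpoint syl (u : word X) : seq X :=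
  if u is l :: u' then
    if ohead (syl u') == Some l.1 then syl u' else l.1 :: syl u'
  else [::].

Lemma adj_syl u : adj (syl u).
Proof.
elim: u => //= l u; case: (ohead (syl u) =P Some l.1) => // /eqP ne ad.
by rewrite adj_cons ne.
Qed.

Lemma mag_support u s : mag (rev u) s != 0 -> subseq s (syl u).
Proof.
elim: u s => [|l u IH] s; first by case: s => [|b s].
rewrite rev_cons mag_rcons /mstep [syl _]/=.
have sub1 s' : mag (rev u) s' != 0 -> subseq s'
    (if ohead (syl u) == Some l.1 then syl u else l.1 :: syl u).
  by move=> /IH ss; case: ifP => // _; apply: subseq_trans ss (subseq_cons _ _).
case: s => [|b s]; first by rewrite addr0; apply: sub1.
have [z|nz] := eqVneq (mag (rev u) (b :: s)) 0; last by move=> _; apply: sub1.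
rewrite z add0r; have [->|_] := eqVneq b l.1; last by rewrite eqxx.
rewrite adj_cons.
case: (altP (ohead s =P _)) => [|hs]; rewrite ?eqxx //=; case: (adj s); rewrite ?eqxx //.
have [->|nz] := eqVneq (mag (rev u) s) 0; first by rewrite mulr0 eqxx.
move=> _; have := IH _ nz; case: ifP => [|_ ss]; last by rewrite /= eqxx.
case: (syl u) => //= c s' /eqP[->]; rewrite eqxx.
case: s hs {z nz} => [_ _|/= d s ne]; first exact: sub0seq.
 case: eqP => // e.
by rewrite e eqxx in ne.
Qed.

(** Iterated, this computes the coefficient at the monomial of all syllables as the product of their
    exponents, which is nonzero. The first block of [u] has [n.+1] letters, all of sign [e] because
    the word is reduced. *)
Lemma mag_syl a e u : reduced ((a, e) :: u) ->
  exists n s, [/\ syl ((a, e) :: u) = a :: s, mag (rev ((a, e) :: u)) s != 0 &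
   mag (rev ((a, e) :: u)) (a :: s) = sgb e * n.+1%:R * mag (rev ((a, e) :: u)) s].
Proof.
elim: u a e => [|[b f] u IH] a e.
  move=> _; exists 0%N, [::]; rewrite mag_nil /mag /mstep /= eqxx /=.
  by split; rewrite ?add0r ?mulr1.
move=> /andP[/= ne red]; have [n [s [syE sn0 sE]]] := IH b f red.
rewrite [syl _]/= -/(syl ((b, f) :: u)) syE /= rev_cons mag_rcons.
set v := mag (rev _) in sn0 sE *.
have ad : adj (b :: s) by rewrite -syE adj_syl.
case: eqP => [[ab]|nab].
  subst b; have fe : f = e.
    by apply/eqP; move: ne; rewrite xpair_eqE eqxx /=; case: (f); case: (e).
  subst f; have vs : mstep v (a, e) s = v s.
    rewrite /mstep; case: s ad {syE sE sn0} => [|c s]; first by rewrite addr0.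
    by move=> /andP[/= ac _]; rewrite eq_sym (negPf ac) addr0.
  exists n.+1, s; split=> //; rewrite vs // {1}/mstep sE eqxx ad /=.
  by rewrite -[n.+2]addn1 natrD; case: (e); rewrite /sgb; ring.
have ba : b != a by apply/eqP => e'; apply: nab; rewrite e'.
have vs : mstep v (a, e) (b :: s) = v (b :: s).
  by rewrite /mstep /= (negPf ba) addr0.
exists 0%N, (b :: s); rewrite vs; split=> //.
  by rewrite sE !mulf_neq0 ?pnatr_eq0 //; case: (f).
rewrite {1}/mstep adj_cons ad andbT [ohead _]/= eqxx /=.
(* A monomial longer than the list of syllables is not a subsequence of it. *)
have -> : v [:: a, b & s] = 0.
  apply/eqP; apply/contraT => /mag_support/size_subseq.
  by rewrite syE /= ltnn.
have -> : Some b != Some a by apply: contra ba => /eqP[->].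
by rewrite add0r mulr1.
Qed.

Lemma mag_neq0 w : reduced w -> w != [::] -> exists2 s, s != [::] & mag w s != 0.
Proof.
rewrite -[w]revK reduced_rev; case: (rev w) => [//|[a e] u] red _.
have [n [s [_ sn0 sE]]] := mag_syl red; exists (a :: s) => //.
by rewrite sE !mulf_neq0 ?pnatr_eq0 //; case: (e).
Qed.

End Magnus.

Definition subgroup (G : groupType) (H : G -> Prop) :=
  [/\ H 1, forall x y, H x -> H y -> H (x * y) & forall x, H x -> H x^-1].

(** Maps on a subgroup are total functions on G that obey the law on the subgroup only; no subgroup
    types have to be built. *)
Definition hom_on (G K : groupType) (H : G -> Prop) (rho : G -> K) :=
  forall x y, H x -> H y -> rho (x * y) = rho x * rho y.

Definition add_on (G : groupType) (H : G -> Prop) (c : G -> int) :=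
  forall x y, H x -> H y -> c (x * y) = (c x + c y)%R.

Section FreeGroup.
Import GRing.Theory Num.Theory.
Variables (X : eqType) (G : groupType) (g : X -> G).
Hypothesis fr : freely g.

Local Notation F := (gen_by g).

Definition mu s x := mag (wordof g x) s.

Lemma muE s w : mu s (weval g w) = mag w s.
Proof.
rewrite /mu /mag (free_foldl _ fr (@mstepK X) (w' := w)) //.
by apply: wordofK; exists w.
Qed.

Lemma mu1 s : mu s 1 = (s == [::])%:R%R.
Proof. by rewrite -(weval_nil g) muE. Qed.

(** The two extreme terms of the product formula are split off: a coefficient is additive up to
    products of strictly shorter ones. The inductions on the size of [s] below rest on this. *)
Lemma muM s x y : adj s -> s != [::] -> F x -> F y ->
  mu s (x * y) = (mu s x + mu s y +
    \sum_(i < (size s).-1) mu (drop i.+1 s) x * mu (take i.+1 s) y)%R.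
Proof.
move=> ad; case: s ad => // b s ad _ [w ->] [w' ->].
rewrite -weval_cat !muE mag_cat // big_ord_recl big_ord_recr /=.
rewrite !add0n drop_size take_size !mag_nil mulr1 mul1r.
rewrite addrA addrAC; congr (_ + _)%R.
by apply: eq_bigr => i _; rewrite !muE.
Qed.

Lemma mu_eq1 x : F x -> (forall s, adj s -> s != [::] -> mu s x = 0%R) -> x = 1.
Proof.
move=> [w ->] mu0; case: (redr w =P [::]) => [e|/eqP ne].
  by rewrite -weval_redr e weval_nil.
have [||s sn] := @mag_neq0 _ (rev (redr w)); first by rewrite reduced_rev reduced_redr.
  by apply: contra ne => /eqP/(canRL revK)->.
rewrite /mag -(foldl_redr (@mstepK X)) -/(mag w) -muE => /negP[]; apply/eqP.
case ad: (adj s); first exact: mu0.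
by rewrite muE mag_adj ?ad.
Qed.

Lemma mu_inj x y : F x -> F y ->
  (forall s, adj s -> s != [::] -> mu s x = mu s y) -> x = y.
Proof.
move=> Fx Fy e; rewrite -[LHS]mulg1 -[RHS](mulKVg x); congr (_ * _).
have Fz : F (x^-1 * y) by apply: gen_byM => //; apply: gen_byV.
symmetry; apply: mu_eq1 => // s; have [n] := ubnP (size s).
elim: n s => // n IH s sz ad sn.
have := e s ad sn; rewrite -{1}(mulKVg x y) muM // big1 => [|i _].
  by rewrite addr0 -{1}[mu s x]addr0 => /addrI.
case: s sz ad {sn} i => [|b s] /= sz ad [i /= li] //.
rewrite IH ?mulr0 //; last exact: (take_sorted (s := b :: s) i.+1 ad).
by rewrite /= size_take; case: ifP; lia.
Qed.

(** Once the shorter coefficients of [x] vanish, [mu s] is additive on the powers of [x], so [n.+1]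
    times [mu s x] is 0. *)
Lemma free_torsion x n : F x -> x ^+ n.+1 = 1 -> x = 1.
Proof.
move=> Fx xn; apply: mu_eq1 => // s; have [m] := ubnP (size s).
elim: m s => // m IH s sz ad sn.
have mun k : mu s (x ^+ k) = (mu s x *+ k)%R.
  elim: k => [|k IHk]; first by rewrite mu1 (negPf sn).
  have Fk : F (x ^+ k).
    by elim: k {IHk} => [|k Fk]; [exact: gen_by1|rewrite expgS; apply: gen_byM].
  rewrite expgS muM // IHk mulrS big1 ?addr0 // => i _.
  case: s sz ad {sn IHk} i => [|b s] /= sz ad [i /= li] //.
  rewrite (IH (drop i s)) ?mul0r //.
  - by rewrite size_drop; lia.
  - exact: (drop_sorted (s := b :: s) i.+1 ad).
  - by rewrite -size_eq0 size_drop; lia.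
have /eqP := mun n.+1; rewrite xn mu1 (negPf sn) eq_sym.
by rewrite mulrn_eq0 /= => /eqP.
Qed.

(** * Endomorphisms of finite order: Minkowski's argument and Magnus coefficients *)

Section FiniteOrder.
Variable H : G -> Prop.
Hypotheses (sH : subgroup H) (HF : forall x, H x -> F x).

Lemma iter_stable (a : G -> G) i x :
  (forall x, H x -> H (a x)) -> H x -> H (iter i a x).
Proof. by move=> aH Hx; elim: i => //= i; apply: aH. Qed.

(* The defect of a Magnus coefficient is additive as soon as the shorter
   coefficients are invariant. *)
Lemma finite_order_id (a : G -> G) r : {morph a : x y / x * y} ->
  (forall x, H x -> H (a x)) -> 0 < r -> (forall x, H x -> iter r a x = x) ->
  (forall c, add_on H c -> forall x, H x -> c (a x) = c x) ->
  forall x, H x -> a x = x.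
Proof.
move=> aM aH r0 ar aff x Hx; apply: mu_inj => [||s]; try by apply: HF; auto.
have [m] := ubnP (size s).
elim: m s x Hx => // m IH s x Hx sz ad sn.
pose d y := (mu s (a y) - mu s y)%R.
have dA : add_on H d.
  move=> y z Hy Hz; rewrite /d aM !muM //; try by apply: HF; auto.
  rewrite (eq_bigr (fun i : 'I__ => mu (drop i.+1 s) y * mu (take i.+1 s) z)%R).
    by ring.
  move=> [i /= li] _; rewrite !IH //; first by rewrite size_take; case: ifP; lia.
  - exact: take_sorted.
  - by case: (s) li.
  - by rewrite size_drop; lia.
  - exact: drop_sorted.
  - by rewrite -size_eq0 size_drop; lia.
(* By [aff], the additive defect [d] is itself constant along the orbit, so the coefficient grows
   linearly; returning after [r] steps forces slope 0. *)
have mui i : mu s (iter i a x) = (mu s x + d x *+ i)%R.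
  elim: i => [|i IHi]; first by rewrite addr0.
  have di : d (iter i a x) = d x.
    elim: i {IHi} => //= i <-; apply: (aff d dA); exact: iter_stable.
  rewrite mulrSr addrA -IHi -di /d /=; by ring.
have /eqP := mui r; rewrite ar // -{1}[mu s x]addr0 => /eqP/addrI/esym/eqP.
by rewrite mulrn_eq0 eqn0Ngt r0 subr_eq0 => /eqP.
Qed.

(** Let l be 3 if r = 2 and 2 otherwise. If l^k divides all differences c(a x) - c(x), the quotients
    d are additive in x, so d is constant modulo l along orbits. Summing over a whole orbit gives r
    d(x) = 0 modulo l, and r can be cancelled: l^(k+1) divides the differences as well. *)
Lemma prime_order_fix (a : G -> G) r : prime r -> {morph a : x y / x * y} ->
  (forall x, H x -> H (a x)) -> (forall x, H x -> iter r a x = x) ->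
  (forall c, add_on H c -> forall x, H x -> (6 %| (c (a x) - c x)%R)%Z) ->
  forall c, add_on H c -> forall x, H x -> c (a x) = c x.
Proof.
move=> pr aM aH ar a6.
have [l [l1 l6 cop]] : exists l, [/\ 1 < l, l %| 6 & coprime l r].
  have [->|r2] := eqVneq r 2; first by exists 3.
  by exists 2; split=> //; rewrite prime_coprime // dvdn_prime2 // eq_sym.
have dl c : add_on H c -> forall x, H x -> (l %| (c (a x) - c x)%R)%Z.
  by move=> cA x Hx; apply: dvdz_trans (a6 c cA x Hx); rewrite /dvdz.
have dlt c t : add_on H c -> forall x, H x -> (l %| (c (iter t a x) - c x)%R)%Z.
  move=> cA x Hx; elim: t => [|t IH]; first by rewrite subrr dvdz0.
  rewrite -(subrKA (c (iter t a x))); apply: rpredD => //.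
  by apply: dl => //; apply: iter_stable.
have dlk k c : add_on H c -> forall x, H x -> ((l ^ k)%N %| (c (a x) - c x)%R)%Z.
  elim: k c => [|k IH] c cA x Hx; first by rewrite expn0 dvd1z.
  pose d y := ((c (a y) - c y) %/ (l ^ k)%N)%Z.
  have dE y : H y -> (d y * Posz (l ^ k) = c (a y) - c y)%R.
    by move=> Hy; rewrite /d divzK //; apply: IH.
  have lk0 : (Posz (l ^ k) != 0)%R by rewrite eqz_nat expn_eq0; case: (l) l1.
  have dA : add_on H d.
    move=> y z Hy Hz; apply: (mulIf lk0); rewrite mulrDl !dE //.
      by rewrite aM !cA; [ring|..]; auto.
    by case: sH => _ + _; apply.
  have sumE i : (exists m : int, c (iter i a x) - c x = (d x *+ i + m * Posz l) * Posz (l ^ k))%R.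
    elim: i => [|i [m mE]]; first by exists 0%R; rewrite !(subrr, mulr0n, mul0r, addr0).
    have /dvdzP[q qE] := dlt d i dA x Hx; exists (m + q)%R.
    rewrite -(subrKA (c (iter i a x))) mE -dE; last exact: iter_stable.
    have -> : d (iter i a x) = (d x + q * Posz l)%R by rewrite -qE; ring.
    by rewrite mulrSr; ring.
  have [m mE] := sumE r; rewrite ar // subrr in mE.
  have {}mE : (d x *+ r + m * Posz l = 0)%R.
    by apply: (mulIf lk0); rewrite mul0r.
  rewrite -dE // expnSr PoszM [(d x * _)%R]mulrC dvdz_mul2l //.
  rewrite -(@Gauss_dvdzr l r); last by rewrite /coprimez /gcdz /= (eqP cop).
  have -> : (Posz r * d x = - m * Posz l)%R.
    by apply/eqP; rewrite -subr_eq0 mulNr opprK mulrC -natz mulr_natr mE.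
  exact: dvdz_mull.
move=> c cA x Hx; apply/eqP; rewrite -subr_eq0; apply/contraT => nz.
(* A nonzero integer of absolute value k is not divisible by [l ^ k], which exceeds k. *)
have := dlk `|c (a x) - c x|%N c cA x Hx.
rewrite /dvdz /= => /dvdn_leq; rewrite lt0n absz_eq0 nz => /(_ isT).
by rewrite leqNgt ltn_expl.
Qed.

(** Reduction to prime order: with [r] the least prime divisor of [j], the power of [a] with
    exponent [j %/ r] has period [r] and is still trivial modulo 6, so it is the identity and
    [j %/ r] is a smaller period of [a]. *)
Lemma order_mod6 j (a : G -> G) : {morph a : x y / x * y} ->
  (forall x, H x -> H (a x)) -> 0 < j -> (forall x, H x -> iter j a x = x) ->
  (forall c, add_on H c -> forall x, H x -> (6 %| (c (a x) - c x)%R)%Z) ->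
  forall x, H x -> a x = x.
Proof.
have [n] := ubnP j; elim: n j a => [//|n IH] j a jn aM aH j0 aj a6.
case: (leqP j 1) => [j1|j1].
  by move: aj; have -> : j = 1%N by lia.
have iM i : {morph iter i a : x y / x * y}.
  by elim: i => [|i IHi] x y /=; rewrite ?IHi ?aM.
pose r := pdiv j; pose m := j %/ r.
have rj : (m * r)%N = j by rewrite divnK ?pdiv_dvd.
have m0 : 0 < m by case: m rj => // rj; rewrite -rj in j0.
have pr : prime r by apply: pdiv_prime.
have mj : m < j by rewrite -rj ltn_Pmulr ?prime_gt1.
apply: (IH m) => //; first by lia.
have iterM k b x : iter (b * k)%N a x = iter b (iter k a) x.
  by elim: b => //= b <-; rewrite mulSn iterD.
have a6m c : add_on H c -> forall x, H x -> (6 %| (c (iter m a x) - c x)%R)%Z.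
  move=> cA x Hx; elim: (m) => [|t IHt]; first by rewrite subrr dvdz0.
  rewrite -(subrKA (c (iter t a x))); apply: rpredD => //.
  by apply: a6 => //; apply: iter_stable.
apply: (@finite_order_id (iter m a) r) => //.
- by move=> x Hx; apply: iter_stable.
- exact: prime_gt0.
- by move=> x Hx; rewrite -iterM mulnC rj aj.
apply: (@prime_order_fix _ r) => //.
- by move=> x Hx; apply: iter_stable.
- by move=> x Hx; rewrite -iterM mulnC rj aj.
Qed.

End FiniteOrder.
End FreeGroup.

(** * Residual finiteness and Schreier bases *)

Definition generates (G : groupType) (H : G -> Prop) r (b : 'I_r -> G) :=
  (forall i, H (b i)) /\ forall S : G -> Prop, subgroup S ->
    (forall i, S (b i)) -> forall h, H h -> S h.

(** Freeness tested against finite groups, because homomorphisms to finite groups are what gets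
    counted. *)
Definition independent (G : groupType) (H : G -> Prop) r (b : 'I_r -> G) :=
  (forall i, H (b i)) /\ forall (K : finGroupType) (f : 'I_r -> K),
    exists rho : G -> K, hom_on H rho /\ forall i, rho (b i) = f i.

(** A duplicate-free list in [P] of maximal length cannot miss an element of [P]. *)
Lemma bounded_enum (T : eqType) (P : T -> Prop) n :
  (forall s, uniq s -> {in s, forall z, P z} -> size s <= n) ->
  exists s, [/\ uniq s, size s <= n & forall z, P z <-> z \in s].
Proof.
move=> bd; pose Q k := `[< exists s, [/\ uniq s, size s = k & {in s, forall z, P z}] >].
have exQ : exists k, Q k by exists 0%N; apply/asboolP; exists [::].
have bdQ k : Q k -> k <= n by move=> /asboolP[s [us <- Ps]]; apply: bd.
case: (ex_maxnP exQ bdQ) => k /asboolP[s [us sk Ps]] kmax.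
exists s; split=> [||z]; first by []; first exact: bd.
split=> [Pz|]; last exact: Ps.
apply/contraT => zs; have: Q k.+1.
  apply/asboolP; exists (z :: s); split; rewrite /= ?zs ?sk //.
  by move=> y; rewrite inE => /predU1P[->//|/Ps].
by move/kmax; rewrite ltnn.
Qed.

Lemma intr_Zp_eq0 m (z : int) : 1 < m -> (z%:~R = 0 :> 'Z_m)%R -> m %| `|z|.
Proof.
case: m => [|[|m]] // _; have V k : (k%:R = 0 :> 'Z_m.+2)%R -> m.+2 %| k.
  by move/(congr1 val); rewrite /= Zp_nat => /eqP.
case: z => k; first exact: V.
by rewrite NegzE GRing.rmorphN /= => /eqP; rewrite GRing.oppr_eq0 => /eqP/V.
Qed.

Section FreeExtension.
Variables (X : eqType) (G : groupType) (g : X -> G).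
Hypothesis fr : freely g.

Lemma free_weval (K : groupType) (k : X -> K) w w' :
  weval g w = weval g w' -> weval k w = weval k w'.
Proof.
move=> e; rewrite -[LHS]mul1g -[RHS]mul1g -!weval_foldl.
by apply: (free_foldl _ fr _ e) => x l; rewrite lval_linv mulgK.
Qed.

Lemma free_extension (K : groupType) (k : X -> K) : exists rho : G -> K,
  hom_on (gen_by g) rho /\ forall w, rho (weval g w) = weval k w.
Proof.
exists (fun x => weval k (wordof g x)).
have E w : weval k (wordof g (weval g w)) = weval k w.
  by apply: free_weval; apply: wordofK; exists w.
by split=> // _ _ [w ->] [w' ->]; rewrite -weval_cat !E weval_cat.
Qed.

End FreeExtension.

(** * Residual finiteness, by truncating Magnus series and reducing them modulo m *)

Section ResiduallyFinite.
Import GRing.Theory.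
Variables (X : finType) (G : groupType) (g : X -> G).
Hypothesis fr : freely g.

Lemma insub_bseqE n (s : seq X) : size s <= n -> insub_bseq n s = s :> seq X.
Proof. by move=> sn; rewrite /insub_bseq insubdK. Qed.

Section MagnusAction.
Variables (n m : nat).
Local Notation E := {ffun n.-bseq X -> 'Z_m}.
Local Open Scope ring_scope.

Definition zstep (v : E) (l : X * bool) : E := [ffun s : n.-bseq X =>
  v s + if s : seq X is b :: s' then
          if (b == l.1) && adj s then (sgb l.2)%:~R * v (insub_bseq n s') else 0
        else 0].

Definition zred (v : seq X -> int) : E := [ffun s : n.-bseq X => (v s)%:~R].

Lemma zstep_zred v l : zstep (zred v) l = zred (mstep v l).
Proof.
apply/ffunP => s; rewrite !ffunE /mstep rmorphD /=; congr (_ + _).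
case: s => [[|b s] /= sz] //=; case: ifP => _ //.
by rewrite ffunE rmorphM /= insub_bseqE // ltnW.
Qed.

(** Every truncated series lifts to an integral one, so [zstepK] is inherited from [mstepK]. *)
Lemma zred_surj v : exists u, v = zred u.
Proof.
exists (fun s => (val (v (insub_bseq n s)))%:Z); apply/ffunP => s.
rewrite ffunE /= -[LHS]natr_Zp; congr (_%:R); congr (nat_of_ord (v _)).
by apply: val_inj; rewrite /= insub_bseqE // size_bseq.
Qed.

Lemma zstepK v l : zstep (zstep v l) (linv l) = v.
Proof. by have [u ->] := zred_surj v; rewrite !zstep_zred mstepK. Qed.

Lemma zstep_inj a : injective (zstep^~ (a, false)).
Proof. by apply: (@can_inj _ _ _ (zstep^~ (a, true))) => v; apply: zstepK. Qed.

Definition zperm a : {perm E} := perm (@zstep_inj a).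

Lemma weval_zperm w : weval zperm w (zred (mag [::])) = zred (mag w).
Proof.
elim/last_ind: w => [|w [a e] IH]; first by rewrite weval_nil perm1.
rewrite weval_rcons permM IH mag_rcons -zstep_zred.
case: e; rewrite /lval /=; last by rewrite permE.
by apply: (@perm_inj _ (zperm a)); rewrite permKV permE (zstepK _ (a, true)).
Qed.

End MagnusAction.

Lemma residually_finite x : gen_by g x -> x <> 1 ->
  exists (K : finGroupType) (rho : G -> K), hom_on (gen_by g) rho /\ rho x <> 1.
Proof.
move=> Fx x1; have [s [ad sn mn]] : exists s, [/\ adj s, s != [::] & mu g s x != 0%R].
  apply: contrapT => nex; apply: x1; apply: (mu_eq1 fr Fx) => s ad sn.
  by apply/eqP/contraT => nz; case: nex; exists s.
case: Fx mn => w ->; rewrite (muE fr) => mn.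
(* The modulus exceeds the absolute value of the coefficient, which thus survives reduction, and it
   is greater than 1. *)
pose m := `|mag w s|.+2; exists {perm {ffun (size s).-bseq X -> 'Z_m}}.
have [rho [rhoM rhoE]] := free_extension fr (@zperm (size s) m).
exists rho; split=> //; rewrite rhoE => e.
have := weval_zperm (size s) m w; rewrite e perm1 => /ffunP/(_ (Bseq (leqnn (size s)))).
rewrite !ffunE /= {1}/mag /= (negPf sn).
move/esym/(@intr_Zp_eq0 m _ isT)/dvdn_leq.
by rewrite lt0n absz_eq0 mn ltnNge leqnSn => /(_ isT).
Qed.

End ResiduallyFinite.

(** * Schreier generators: generation and independence *)

Section Schreier.
Variables (X : finType) (G : groupType) (g : X -> G).
Hypothesis fr : freely g.
Variable H : G -> Prop.
Hypotheses (sH : subgroup H) (HF : forall x, H x -> gen_by g x).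

Local Notation F := (gen_by g).

(* The shortlex rank of a word: its value as a numeral without zero digit. *)
Definition wrank (w : word X) :=
  foldl (fun n l => n * #|{: X * bool}|.+1 + (enum_rank l).+1)%N 0%N w.

Lemma wrank_rcons w l :
  wrank (rcons w l) = (wrank w * #|{: X * bool}|.+1 + (enum_rank l).+1)%N.
Proof. by rewrite /wrank foldl_rcons. Qed.

Lemma wrank_inj : injective wrank.
Proof.
have dig (l : X * bool) : (enum_rank l).+1 < #|{: X * bool}|.+1.
  by rewrite ltnS ltn_ord.
elim/last_ind => [|w l IH] w'; case/lastP: w' => [|w' l'] //.
- by rewrite wrank_rcons addnS.
- by rewrite wrank_rcons addnS.
rewrite !wrank_rcons => e.
have el : enum_rank l = enum_rank l'.
  apply/val_inj/succn_inj; have := congr1 (modn^~ #|{: X * bool}|.+1) e.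
  by rewrite !modnMDl !modn_small.
move: e; rewrite el => /addIn/eqP; rewrite eqn_pmul2r // => /eqP/IH->.
by rewrite (enum_rank_inj el).
Qed.

Definition coset_min (x : G) (w : word X) := H (weval g w * x^-1) /\
  forall w', H (weval g w' * x^-1) -> wrank w <= wrank w'.

Lemma coset_min_unique x w w' : coset_min x w -> coset_min x w' -> w = w'.
Proof.
move=> [Hw mw] [Hw' mw']; apply: wrank_inj; apply/eqP.
by rewrite eqn_leq mw // mw'.
Qed.

Lemma coset_min_exists x : F x -> exists w, coset_min x w.
Proof.
case=> w0 ->; pose P n := `[< exists w, wrank w = n /\ H (weval g w * (weval g w0)^-1) >].
have exP : exists n, P n.
  exists (wrank w0); apply/asboolP; exists w0; rewrite mulgV.
  by split=> //; case: sH.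
case: (ex_minnP exP) => n /asboolP[w [wn Hw]] minn.
exists w; split=> // w' Hw'; rewrite wn; apply: minn.
by apply/asboolP; exists w'.
Qed.

(* The Schreier transversal: the shortlex minimal word of the coset [H x]. *)
Definition srep (x : G) : word X :=
  if pselect (exists w, coset_min x w) is left h then projT1 (cid h) else [::].

Definition rep x := weval g (srep x).

Lemma srepP x : F x -> coset_min x (srep x).
Proof.
by move=> /coset_min_exists h; rewrite /srep; case: pselect => // h'; case: cid.
Qed.

Lemma F_weval w : F (weval g w). Proof. by exists w. Qed.

Lemma F_letter a : F (g a).
Proof. by exists [:: (a, false)]; rewrite weval_cons weval_nil mulg1. Qed.

Lemma F_rep x : F (rep x). Proof. exact: F_weval. Qed.

Lemma rep_coset x : F x -> H (rep x * x^-1).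
Proof. by case/srepP. Qed.

Lemma srepE x y : F x -> F y -> H (y * x^-1) -> srep y = srep x.
Proof.
move=> Fx Fy Hyx; have [sH1 sHM sHV] := sH; apply: (@coset_min_unique y).
  exact: srepP.
have [Hx mx] := srepP Fx; split.
  rewrite -(mulgVK x (weval _ _)) -mulgA; apply: sHM => //.
  by rewrite -[_ * _]invgK invgM invgK; apply: sHV.
move=> w' Hw'; apply: mx; rewrite -(mulgVK y (weval _ _)) -mulgA.
exact: sHM.
Qed.

Lemma srep_rep x : F x -> srep (rep x) = srep x.
Proof. by move=> Fx; apply: srepE => //; [apply: F_rep | apply: rep_coset]. Qed.

Lemma srep_mulr x y z : F x -> F y -> F z -> srep x = srep y ->
  srep (x * z) = srep (y * z).
Proof.
have [sH1 sHM sHV] := sH.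
move=> Fx Fy Fz e; apply: srepE; try exact: gen_byM.
have -> : x * z * (y * z)^-1 = (rep x * x^-1)^-1 * (rep y * y^-1).
  by rewrite !invgM invgK /rep e !mulgA mulgK mulgVK.
by apply: sHM; [apply: sHV|]; apply: rep_coset.
Qed.

Lemma srep_mull h x : H h -> F x -> srep (h * x) = srep x.
Proof.
move=> Hh Fx; apply: srepE => //; last by rewrite mulgK.
by apply: gen_byM => //; apply: HF.
Qed.

Lemma srep1 : srep 1 = [::].
Proof.
have [sH1 _ _] := sH; apply: (@coset_min_unique 1); first exact/srepP/gen_by1.
by split=> //; rewrite weval_nil invg1 mulg1.
Qed.

(** The transversal is prefix-closed: a word of smaller rank in the coset of [p], followed by [l],
    would beat [srep x]. *)
Lemma srep_prefix x p l : F x -> srep x = rcons p l -> srep (weval g p) = p.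
Proof.
have [sH1 sHM sHV] := sH; move=> Fx e; have [Hx mx] := srepP Fx.
apply: (@coset_min_unique (weval g p)); first exact/srepP/F_weval.
split; first by rewrite mulgV.
move=> w' Hw'; have: wrank (srep x) <= wrank (rcons w' l).
  apply: mx; rewrite weval_rcons.
  have -> : weval g w' * lval g l * x^-1 =
      (weval g w' * (weval g p)^-1) * (rep x * x^-1).
    by rewrite /rep e weval_rcons !mulgA mulgVK.
  by apply: sHM => //; apply: rep_coset.
by rewrite e !wrank_rcons leq_add2r leq_pmul2r.
Qed.

(** The edges of the coset graph, from the coset of the transversal word [z.1] along [z.2], whose
    generator is nontrivial. The remaining edges form the tree of the transversal. *)
Definition schreier_set (z : word X * X) :=
  srep (weval g z.1) = z.1 /\ weval g z.1 * g z.2 <> rep (weval g z.1 * g z.2).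

Definition schreier_gen (z : word X * X) : G :=
  weval g z.1 * g z.2 * (rep (weval g z.1 * g z.2))^-1.

Lemma schreier_gen_in z : H (schreier_gen z).
Proof.
have [_ _ sHV] := sH; rewrite /schreier_gen -[_ * _]invgK invgM invgK.
apply/sHV/rep_coset/gen_byM; [exact: F_weval|exact: F_letter].
Qed.

(** Along a word w, the element [w (rep w)^-1] is multiplied at each letter by the generator of the
    edge crossed, or by its inverse for an inverse letter. On [H] the representative is 1, so the
    product is the element itself. *)
Lemma schreier_generation (S : G -> Prop) : subgroup S ->
  (forall z, schreier_set z -> S (schreier_gen z)) -> forall h, H h -> S h.
Proof.
move=> [S1 SM SV] Sgen; suff key w : S (weval g w * (rep (weval g w))^-1).
  move=> h Hh; have [w hE] := HF Hh; have := key w; rewrite -hE.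
  have -> : rep h = 1; last by rewrite invg1 mulg1.
  by rewrite -[h]mulg1 /rep srep_mull ?srep1 ?weval_nil //; apply: gen_by1.
have edge x a : F x -> S (rep x * g a * (rep (x * g a))^-1).
  move=> Fx; have e : rep (x * g a) = rep (rep x * g a).
    rewrite /rep; congr weval; apply: srep_mulr => //; last by rewrite srep_rep.
    - exact: F_rep.
    - exact: F_letter.
  rewrite e; have [t|nt] := pselect (rep x * g a = rep (rep x * g a)).
    by rewrite {1}t mulgV.
  by apply: (Sgen (srep x, a)); split=> //=; apply: srep_rep.
elim/last_ind: w => [|w [a e] IH].
  by rewrite weval_nil /rep srep1 weval_nil mulgV.
set x := weval g w in IH; have Fx : F x by apply: F_weval.
rewrite weval_rcons -/x; case: e; rewrite /lval /=.
  have Fz : F (x * (g a)^-1) by apply: gen_byM => //; apply/gen_byV/F_letter.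
  have := SM _ _ IH (SV _ (edge _ a Fz)).
  by rewrite mulgVK !invgM !invgK !mulgA mulgVK.
by have := SM _ _ IH (edge _ a Fx); rewrite !mulgA mulgVK.
Qed.

Section Cocycle.
Variables (K : groupType) (f : word X * X -> K).

Definition label x a : K :=
  if `[< rep x * g a = rep (x * g a) >] then 1 else f (srep x, a).

(* The action of the free group on pairs (coset, element of K) twisted by the
   labels; tree edges carry the trivial label. *)
Definition cstep (s : G * K) (l : X * bool) : G * K :=
  if l.2 then (s.1 * (g l.1)^-1, s.2 * (label (s.1 * (g l.1)^-1) l.1)^-1)
  else (s.1 * g l.1, s.2 * label s.1 l.1).

Lemma cstepK s l : cstep (cstep s l) (linv l) = s.
Proof.
by case: s => x k; case: l => a []; rewrite /cstep /= ?mulgVK ?mulgK // mulgVK.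
Qed.

Definition cpath x w := (foldl cstep (x, 1) w).2.

Lemma foldl_cstep x k w : foldl cstep (x, k) w = (x * weval g w, k * cpath x w).
Proof.
rewrite /cpath; elim/last_ind: w => [|w [a e] IH].
  by rewrite weval_nil /= !mulg1.
rewrite !foldl_rcons (IH) weval_rcons.
have e1 : (foldl cstep (x, 1) w).1 = x * weval g w.
  elim/last_ind: (w) => [|v [b f'] IHv]; first by rewrite weval_nil mulg1.
  by rewrite foldl_rcons /cstep weval_rcons /lval /=; case: f'; rewrite /= IHv mulgA.
by rewrite /cstep /lval /=; case: e; rewrite /= e1 !mulgA.
Qed.

Lemma cpath_cat x w w' : cpath x (w ++ w') = cpath x w * cpath (x * weval g w) w'.
Proof. by rewrite /cpath foldl_cat !foldl_cstep /= !mul1g. Qed.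

Lemma cpath_winv x w : cpath (x * weval g w) (winv w) = (cpath x w)^-1.
Proof.
apply/esym/mulg1_eq; rewrite -cpath_cat /cpath.
suff -> s : foldl cstep s (w ++ winv w) = s by [].
elim: w s => //= l w IH s; rewrite /winv /= rev_cons -cats1 catA foldl_cat IH.
exact: cstepK.
Qed.

Lemma label_mull h x a : H h -> F x -> label (h * x) a = label x a.
Proof.
move=> Hh Fx; rewrite /label /rep -mulgA !(srep_mull Hh) //.
by apply: gen_byM => //; apply: F_letter.
Qed.

Lemma cpath_mull h x w : H h -> F x -> cpath (h * x) w = cpath x w.
Proof.
move=> Hh Fx; elim/last_ind: w => // w [a e] IH.
rewrite -cats1 !cpath_cat IH; congr (_ * _); rewrite /cpath /= /cstep /=.
have Fa : F (g a) by apply: F_letter.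
have Fw : F (x * weval g w) by apply: gen_byM => //; apply: F_weval.
case: e; rewrite /= -!mulgA (label_mull _ Hh) //.
by apply: gen_byM => //; apply: gen_byM; [exact: F_weval|exact: gen_byV].
Qed.

(** By [srep_prefix] a transversal word crosses tree edges only, possibly backwards. *)
Lemma cpath_srep x : F x -> cpath 1 (srep x) = 1.
Proof.
move sx: (srep x) => w; elim/last_ind: w x sx => // w [a e] IH x sx Fx.
have sw := srep_prefix Fx sx; have rw : rep (weval g w) = weval g w by rewrite /rep sw.
have rx : rep (rep x) = rep x by rewrite /rep srep_rep.
have rxE : rep x = weval g w * lval g (a, e) by rewrite /rep sx weval_rcons.
rewrite -cats1 cpath_cat (IH (weval g w)) //; last exact: F_weval.
rewrite !mul1g /cpath /= /cstep /label /=.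
case: e {sx} rxE; rewrite /lval /= => rxE; rewrite -rxE !mul1g.
  by rewrite asboolT ?invg1 // rx rxE mulgVK rw.
by rewrite asboolT // rw -rxE rx.
Qed.

Lemma cpath_schreier z : schreier_set z ->
  exists w, schreier_gen z = weval g w /\ cpath 1 w = f z.
Proof.
case: z => p a [/= sp ne]; set y := weval g p * g a in ne.
have Fp : F (weval g p) by apply: F_weval.
have Fy : F y by apply: gen_byM => //; apply: F_letter.
exists (rcons p (a, false) ++ winv (srep y)).
rewrite weval_cat weval_winv weval_rcons /lval /=; split=> //.
rewrite -cats1 !cpath_cat -{1}sp cpath_srep // !mul1g weval_cat weval_cons weval_nil mulg1.
rewrite /lval /= -/y.
have -> : cpath y (winv (srep y)) = 1.
  have yE : y * (rep y)^-1 * rep y = y by rewrite mulgVK.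
  rewrite -{1}yE cpath_mull; last exact: F_rep; last first.
    have [_ _ sHV] := sH.
    by rewrite -[_ * _]invgK invgM invgK; apply/sHV/rep_coset.
  by rewrite -[rep y]mul1g cpath_winv cpath_srep // invg1.
rewrite mulg1.
rewrite /cpath /= /cstep /= mul1g /label asboolF ?sp // => e.
by case: ne; rewrite -e /rep sp.
Qed.

(** The image of x is the product of the labels read from the coset of 1 along a word of x. Labels
    depend on the coset only, so the path may equally start at an element of [H], and the product is
    multiplicative there. The path of [schreier_gen z] leaves the tree exactly once, at the edge
    [z]. *)
Lemma cocycle_hom : exists rho : G -> K, hom_on H rho /\
  forall z, schreier_set z -> rho (schreier_gen z) = f z.
Proof.
exists (fun x => cpath 1 (wordof g x)).
have E w : cpath 1 (wordof g (weval g w)) = cpath 1 w.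
  rewrite /cpath; congr snd; apply: (free_foldl _ fr cstepK).
  by apply: wordofK; apply: F_weval.
split=> [x y Hx Hy|z /cpath_schreier[w [-> <-]]]; last exact: E.
have [[w xE] [w' yE]] := (HF Hx, HF Hy).
rewrite xE yE -weval_cat !E cpath_cat; congr (_ * _).
by rewrite mul1g -xE -[x]mulg1 cpath_mull //; apply: gen_by1.
Qed.

End Cocycle.

(** Any finite list of nontrivial Schreier generators is allowed, since the full set is not yet
    known to be finite. *)
Lemma schreier_independent (s : seq (word X * X)) : uniq s ->
  {in s, forall z, schreier_set z} ->
  independent H (fun i => schreier_gen (tnth (in_tuple s) i)).
Proof.
move=> us sS; split=> [i|K f]; first exact: schreier_gen_in.
pose f' z : K := if insub (index z s) is Some i then f i else 1.
have [rho [rhoM rhoE]] := cocycle_hom f'; exists rho; split=> // i.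
rewrite rhoE; last by apply: sS; apply: mem_tnth.
rewrite /f' (tnth_nth (tnth (in_tuple s) i)) /= index_uniq //.
by rewrite insubT //= => ?; congr f; apply: val_inj.
Qed.

Lemma schreier_basis n :
  (forall s, uniq s -> {in s, forall z, schreier_set z} -> size s <= n) ->
  exists r (b : 'I_r -> G), [/\ r <= n, generates H b & independent H b].
Proof.
move=> /bounded_enum[s [us sn sE]].
exists (size s), (fun i => schreier_gen (tnth (in_tuple s) i)).
split=> //; last by apply: schreier_independent => // z /sE.
split=> [i|S sS Sb]; first exact: schreier_gen_in.
apply: schreier_generation => // z /sE zs.
have lt : index z s < size s by rewrite index_mem.
by have := Sb (Ordinal lt); rewrite (tnth_nth z) /= nth_index.
Qed.

End Schreier.

(** * Preperiod and period *)

Section HomOn.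
Variables (G K : groupType) (H : G -> Prop) (rho : G -> K).
Hypotheses (sH : subgroup H) (rhoM : hom_on H rho).

Lemma hom_on1 : rho 1 = 1.
Proof. by have [H1 _ _] := sH; apply: (@mulgI _ (rho 1)); rewrite -rhoM // !mulg1. Qed.

Lemma hom_onV x : H x -> rho x^-1 = (rho x)^-1.
Proof.
have [H1 _ HV] := sH; move=> Hx; apply/esym/mulg1_eq.
by rewrite -rhoM ?mulgV ?hom_on1 //; apply: HV.
Qed.

End HomOn.

Lemma subgroup_equalizer (G K : groupType) (H : G -> Prop) (rho rho' : G -> K) :
  subgroup H -> hom_on H rho -> hom_on H rho' ->
  subgroup (fun x => H x /\ rho x = rho' x).
Proof.
move=> sH rM rM'; have [H1 HM HV] := sH; split.
- by rewrite !(hom_on1 sH).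
- by move=> x y [Hx ex] [Hy ey]; rewrite rM ?rM' ?ex ?ey; auto.
- by move=> x [Hx ex]; rewrite (hom_onV sH) // (hom_onV sH) // ex; auto.
Qed.

Section Pull.
Variables (G : groupType) (H H' : G -> Prop) (phi : G -> G).
Hypotheses (sH : subgroup H) (sH' : subgroup H').
Hypothesis phiM : {morph phi : x y / x * y}.
Hypothesis phiH : forall h, H h -> H' (phi h).
Hypothesis phi_onto : forall h', H' h' -> exists h, H h /\ phi h = h'.
Variables (r q : nat) (b : 'I_r -> G) (e : 'I_q -> G).
Hypotheses (gb : generates H b) (ie : independent H' e).

Lemma hom_on_pull (K : groupType) (rho : G -> K) :
  hom_on H' rho -> hom_on H (rho \o phi).
Proof. by move=> rM x y Hx Hy; rewrite /= phiM rM; auto. Qed.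

(** [T] is composition with the surjection phi, hence injective. Homomorphisms on [H'] are given by
    values on the independent family [e], those on [H] are recorded on the generators [b]. *)
Lemma pull_inj (K : finGroupType) : exists T : {ffun 'I_q -> K} -> {ffun 'I_r -> K},
  injective T /\ forall f, exists rho, hom_on H' rho /\ forall i, T f i = rho (phi (b i)).
Proof.
have [He ext] := ie; have [Hb gen] := gb.
pose rho (f : {ffun 'I_q -> K}) := projT1 (cid (ext K f)).
have rhoP f : hom_on H' (rho f) /\ forall i, rho f (e i) = f i by rewrite /rho; case: cid.
exists (fun f => [ffun i => rho f (phi (b i))]); split; last first.
  by move=> f; exists (rho f); have [rM _] := rhoP f; split=> // i; rewrite ffunE.
move=> f f' /ffunP eT; apply/ffunP => i.
have [rM rE] := rhoP f; have [rM' rE'] := rhoP f'; rewrite -rE -rE'.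
have [h [Hh <-]] := phi_onto (He i).
have [] := gen _ (subgroup_equalizer sH (hom_on_pull rM) (hom_on_pull rM')) _ h Hh.
  by move=> j; split=> //; have := eT j; rewrite !ffunE.
by [].
Qed.

Lemma pull_leq : q <= r.
Proof.
(* With a group of two elements the count reads [2 ^ q <= 2 ^ r]. *)
have [T [Ti _]] := pull_inj 'S_2.
have := leq_card T Ti; rewrite !card_ffun !card_ord card_Sn.
by rewrite leq_exp2l.
Qed.

(* When both ranks agree, the restriction map between the finite sets of
   homomorphisms is a bijection, so every homomorphism factors through phi. *)
Lemma pull_ker (K : finGroupType) (rho : G -> K) h :
  q = r -> hom_on H rho -> H h -> phi h = 1 -> rho h = 1.
Proof.
move=> qr rM Hh h1; have [T [Ti TE]] := pull_inj K; have [Hb gen] := gb.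
have Tb : bijective T by apply: inj_card_bij => //; rewrite !card_ffun !card_ord qr.
have [T' _ TK'] := Tb; have [rho' [rM' rE']] := TE (T' [ffun i => rho (b i)]).
have [] := gen _ (subgroup_equalizer sH rM (hom_on_pull rM')) _ h Hh.
  by move=> j; split=> //=; rewrite -rE' TK' ffunE.
by move=> _ ->; rewrite /= h1 (hom_on1 sH').
Qed.

End Pull.

(** Two of the first [#|T| + 1] values agree, so from some index below [C] on there is a period at
    most [#|T| <= C], which divides the factorial. *)
Lemma eventually_periodic (T : finType) (e : nat -> T) C m k :
  (forall i j, e i = e j -> e i.+1 = e j.+1) -> #|T| <= C -> C <= m ->
  e (m + k * C`!)%N = e m.
Proof.
move=> eS TC Cm.
have [i [j [ij jT eij]]] : exists i j, [/\ i < j, j <= #|T| & e i = e j].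
  apply: contrapT => nex; have inj : injective (fun i : 'I_#|T|.+1 => e i).
    move=> i j eij; apply: val_inj => /=; case: (ltngtP i j) => // lt.
      by case: nex; exists i, j; split=> //; rewrite -ltnS.
    by case: nex; exists j, i; split=> //; rewrite -ltnS.
  by have := leq_card _ inj; rewrite card_ord ltnn.
have per n : e (i + n)%N = e (j + n)%N.
  by elim: n => [|n IH]; [rewrite !addn0|rewrite !addnS; apply: eS].
have perm' l n : i <= n -> e (n + l * (j - i))%N = e n.
  elim: l => [|l IH] ni; first by rewrite addn0.
  rewrite mulSn addnCA -(IH ni).
  have -> : (j - i + (n + l * (j - i)) = j + (n + l * (j - i) - i))%N.
    by move: (l * (j - i))%N => d; lia.
  by rewrite -per; congr e; lia.
have /dvdnP[l ->] : j - i %| C`! by apply: dvdn_fact; lia.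
by rewrite mulnA; apply: perm'; lia.
Qed.

(** * Images of V under the iterates of phi, and bounds on preperiod and period *)

Section Bound.
Variables (X : finType) (G : groupType) (g : X -> G).
Hypothesis fr : freely g.
Variable V : G -> Prop.
Hypotheses (sV : subgroup V) (VF : forall x, V x -> gen_by g x).
Variables (E : finType) (cls : G -> E).
Hypothesis clsE : forall x y, cls x = cls y <-> V (x * y^-1).
Variable phi : G -> G.
Hypothesis phiM : {morph phi : x y / x * y}.
Hypothesis phiV : forall x, V x -> V (phi x).

Lemma iter_morphM k : {morph iter k phi : x y / x * y}.
Proof. by elim: k => [|k IH] x y //=; rewrite IH phiM. Qed.

Lemma iter_morph1 k : iter k phi 1 = 1.
Proof. by apply: (@mulgI _ (iter k phi 1)); rewrite -iter_morphM !mulg1. Qed.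

Lemma iter_morphV k x : iter k phi x^-1 = (iter k phi x)^-1.
Proof. by apply/esym/mulg1_eq; rewrite -iter_morphM mulgV iter_morph1. Qed.

Lemma iter_in k x : V x -> V (iter k phi x).
Proof. by move=> Vx; elim: k => //= k; apply: phiV. Qed.

Definition img k (y : G) := exists v, V v /\ iter k phi v = y.

Lemma img_subgroup k : subgroup (img k).
Proof.
have [V1 VM VV] := sV; split.
- by exists 1; rewrite iter_morph1.
- by move=> _ _ [v [Vv <-]] [w [Vw <-]]; exists (v * w); rewrite iter_morphM; auto.
- by move=> _ [v [Vv <-]]; exists v^-1; rewrite iter_morphV; auto.
Qed.

Lemma img_sub k x : img k x -> V x.
Proof. by move=> [v [Vv <-]]; apply: iter_in. Qed.

Lemma img_leq k l x : k <= l -> img l x -> img k x.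
Proof.
move=> kl [v [Vv <-]]; exists (iter (l - k) phi v); split; first exact: iter_in.
by rewrite -iterD subnKC.
Qed.

Lemma imgF k x : img k x -> gen_by g x.
Proof. by move/img_sub/VF. Qed.

Definition free_rank k r := exists b : 'I_r -> G,
  generates (img k) b /\ independent (img k) b.

(** A Schreier generator is determined by the coset of its transversal word and its letter, whence
    the crude bound index times [#|X|]. *)
Lemma free_rank0 : exists2 r, r <= #|E| * #|X| & free_rank 0 r.
Proof.
have sI := img_subgroup 0; have IF x : img 0 x -> gen_by g x by apply: imgF.
have [|r [b [rn gb ib]]] := @schreier_basis _ _ _ fr _ sI IF (#|E| * #|X|)%N.
  move=> s us sS; rewrite -card_prod -(size_map (fun z => (cls (weval g z.1), z.2))).
  rewrite -(card_uniqP _) ?max_card // map_inj_in_uniq //.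
  move=> [p a] [p' a'] /sS[/= pE _] /sS[/= pE' _] [/clsE e ->].
  rewrite -pE -pE'; congr (_, _); apply: (srepE sI); try exact: F_weval.
  by exists (weval g p * (weval g p')^-1).
by exists r => //; exists b.
Qed.

Lemma img_phi k x : img k x -> img k.+1 (phi x).
Proof. by move=> [v [Vv <-]]; exists v. Qed.

Lemma img_onto k y : img k.+1 y -> exists x, img k x /\ phi x = y.
Proof. by move=> [v [Vv <-]]; exists (iter k phi v); split=> //; exists v. Qed.

(** The image may have infinite index, so counting cosets says nothing here. But every finite list
    of its Schreier generators is independent, and [pull_leq] bounds the list by the number of
    generators of the previous image. *)
Lemma free_rankS k r : free_rank k r -> exists2 r', r' <= r & free_rank k.+1 r'.
Proof.
move=> [b [gb ib]]; have IF x : img k.+1 x -> gen_by g x by apply: imgF.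
have [|r' [b' [rn gb' ib']]] := @schreier_basis _ _ _ fr _ (img_subgroup k.+1) IF r.
  move=> s us sS.
  have := schreier_independent fr (img_subgroup k.+1) IF us sS.
  apply: (pull_leq (img_subgroup k) phiM _ _ gb).
    exact: img_phi.
  exact: img_onto.
by exists r' => //; exists b'.
Qed.

Lemma free_rank_inj k r : free_rank k r -> free_rank k.+1 r ->
  forall x, img k x -> phi x = 1 -> x = 1.
Proof.
move=> [b [gb _]] [b' [_ ib']] x Ix x1; apply: contrapT => nx.
have [K [rho [rM]]] := residually_finite fr (imgF Ix) nx; apply.
apply: (pull_ker (img_subgroup k) (img_subgroup k.+1) phiM _ _ gb ib') Ix x1 => //.
- exact: img_phi.
- exact: img_onto.
by move=> y z Iy Iz; apply: rM; apply: imgF; eassumption.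
Qed.

(** A kernel element in [img n] lies in all [img k] with [k <= n], so by [free_rank_inj] the rank
    would drop [n.+1] times, starting from at most [n]. *)
Lemma img_inj x j : img (#|E| * #|X|) x -> iter j phi x = 1 -> x = 1.
Proof.
set n := (_ * _)%N => Ix; suff inj y : img n y -> phi y = 1 -> y = 1.
  elim: j x Ix => // j IH x Ix; rewrite iterSr => /IH e; apply: inj => //.
  by apply: e; apply: (@img_leq _ n.+1) => //; apply: img_phi.
move=> Iy y1; apply: contrapT => ny.
suff H k : k <= n.+1 -> exists2 r, (r + k <= n)%N & free_rank k r.
  by have [r] := H n.+1 (leqnn _); rewrite addnS ltnNge leq_addl.
elim: k => [|k IH] kn; first by have [r] := free_rank0; exists r; rewrite ?addn0.
have [r rk fk] := IH (ltnW kn); have [r' rr' fk'] := free_rankS fk.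
exists r' => //; move: rr'; rewrite leq_eqVlt => /predU1P[e|]; last by lia.
rewrite e in fk'; case: ny; apply: (free_rank_inj fk fk' _ y1).
by apply: img_leq Iy; rewrite -ltnS.
Qed.

Lemma cls_step x y : cls x = cls y -> cls (phi x) = cls (phi y).
Proof.
move/clsE/phiV; rewrite phiM => Vxy; apply/clsE.
by rewrite -[(phi y)^-1](iter_morphV 1).
Qed.

Section Constant.
Variable C : nat.
Hypothesis C1 : #|E| + #|E| * #|X| <= C.

(** The cosets of the iterates of [x] recur from step [#|E|] on and end at V, so the iterate at step
    [#|E|] is already in V. Another [#|E| * #|X|] steps bring it to where phi is injective. *)
Lemma kernel_stable x j : iter (C + j) phi x = 1 -> iter C phi x = 1.
Proof.
move=> x1; pose s := #|E|.
have Vs : V (iter s phi x).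
  (* Moving on by [C + j] periods leads beyond step [C + j], where all iterates are 1. *)
  have /clsE := @eventually_periodic E (fun i => cls (iter i phi x)) s s (C + j)
    (fun i k e => cls_step e) (leqnn _) (leqnn _).
  have -> : (s + (C + j) * s`! = s + (C + j) * (s`! - 1) + (C + j))%N.
    by have := fact_gt0 s; nia.
  rewrite iterD x1 iter_morph1 mul1g => Vn.
  have [_ _ VV] := sV; by rewrite -[iter _ _ _]invgK; apply: VV.
apply: (@img_inj _ j); last by rewrite -iterD addnC.
exists (iter (C - s - #|E| * #|X|) phi (iter s phi x)); split; first exact: iter_in.
by rewrite -!iterD; congr iter; rewrite /s; lia.
Qed.

(** Some iterate of phi kills [x^-1 * iter t phi x], so the C-th one does by [kernel_stable]. The
    same [t] is kept, which makes [t = 1] the aperiodic case. *)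
Lemma preperiod p t : iter p phi =1 iter (p + t) phi ->
  iter C phi =1 iter (C + t) phi.
Proof.
move=> e x; suff : iter C phi (x^-1 * iter t phi x) = 1.
  by rewrite iter_morphM iter_morphV -iterD => /(canRL (mulKVg _)); rewrite mulg1.
apply: (@kernel_stable _ p); rewrite iter_morphM iter_morphV -iterD.
by rewrite -addnA [iter (C + (p + t)) _ _]iterD -e -iterD mulVg.
Qed.

Lemma aperiodic_bound : (exists m, iter m phi =1 iter m.+1 phi) <->
  iter C phi =1 iter C.+1 phi.
Proof.
split=> [[m e]|]; last by exists C.
by rewrite -addn1; apply: (@preperiod m); rewrite addn1.
Qed.

Section Periodic.
Import GRing.Theory.
Hypothesis C2 : 6 ^ (#|E| * #|X|) <= C.
Variable t : nat.
Hypotheses (t0 : 0 < t) (phit : iter C phi =1 iter (C + t) phi).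

Lemma periodic n k x : C <= n -> iter (n + k * t) phi x = iter n phi x.
Proof.
move=> Cn; elim: k => [|k IH]; first by rewrite addn0.
rewrite -{}IH mulSn; have -> : (n + (t + k * t) = n + k * t - C + (C + t))%N.
  by move: (k * t)%N => d; lia.
by rewrite iterD -phit -iterD subnK //; move: (k * t)%N => d; lia.
Qed.

(** By periodicity [iter (C * t) phi] fixes this element of V, and so exhibits it as the image under
    [iter C phi] of an element of V. *)
Lemma V_img x : V (iter C phi x) -> img C (iter C phi x).
Proof.
move=> Vx; exists (iter (C * t - C) phi (iter C phi x)); split; first exact: iter_in.
by rewrite -iterD subnKC ?leq_pmulr // -iterD addnC periodic.
Qed.

(** [c] is additive on [img C] only. Precomposed with [iter (C * t) phi] it is additive on V and
    keeps its values on later iterates; modulo 6 it is then determined by the generators of V, and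
    the pigeonhole principle applies. *)
Lemma add_on_mod6 c : add_on (img C) c ->
  forall x, img C x -> (6 %| (c (iter C`! phi x) - c x)%R)%Z.
Proof.
move=> cA _ [v [Vv <-]].
pose c' y := c (iter (C * t) phi y).
have c'A : add_on V c'.
  have imgV y : V y -> img C (iter (C * t) phi y).
    by move=> Vy; apply: (@img_leq _ (C * t)); [exact: leq_pmulr|exists y].
  by move=> y z Vy Vz; rewrite /c' iter_morphM cA; auto.
have c'E n : C <= n -> c' (iter n phi v) = c (iter n phi v).
  by move=> Cn; rewrite /c' -iterD addnC periodic.
rewrite -iterD addnC -!c'E ?leq_addr //.
have [r rn [b [[Hb gen] _]]] := free_rank0.
have VI y : V y -> img 0 y by exists y.
have IV y : img 0 y -> V y by move=> [? [? <-]].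
(* The homomorphism from V to Z/6 obtained by precomposing [c'] with [iter i phi], recorded on
   generators. It determines the next one, by a further precomposition with phi. *)
pose e i : {ffun 'I_r -> 'Z_6} := [ffun k => (c' (iter i phi (b k)))%:~R]%R.
have eP i j : e i = e j ->
    forall y, V y -> ((c' (iter i phi y))%:~R = (c' (iter j phi y))%:~R :> 'Z_6)%R.
  move=> eij y /VI Iy; have [V1 VM VV] := sV.
  have c'M k u w : V u -> V w -> ((c' (iter k phi (u * w)%g))%:~R =
      (c' (iter k phi u))%:~R + (c' (iter k phi w))%:~R :> 'Z_6)%R.
    by move=> Vu Vw; rewrite iter_morphM c'A ?rmorphD //; apply: iter_in.
  have c'1 k : ((c' (iter k phi 1%g))%:~R = 0 :> 'Z_6)%R.
    by apply: (@addrI _ (c' (iter k phi 1%g))%:~R%R); rewrite -c'M // mulg1 addr0.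
  have c'V k u : V u -> ((c' (iter k phi u^-1%g))%:~R = - (c' (iter k phi u))%:~R :> 'Z_6)%R.
    move=> Vu; apply/esym/eqP; rewrite eqr_oppLR -addr_eq0 addrC -c'M //; last exact: VV.
    by rewrite mulVg c'1.
  pose S u := V u /\ ((c' (iter i phi u))%:~R = (c' (iter j phi u))%:~R :> 'Z_6)%R.
  suff [] : S y by [].
  apply: gen Iy => [|k]; last first.
    by split; [exact: IV|have /ffunP/(_ k) := eij; rewrite !ffunE].
  split.
  - by split; rewrite ?c'1.
  - by move=> u w [Vu eu] [Vw ew]; split; [exact: VM|rewrite !c'M // eu ew].
  - by move=> u [Vu eu]; split; [exact: VV|rewrite !c'V // eu].
have eC : e (C + C`!)%N = e C.
  rewrite -[C`!]mul1n; apply: eventually_periodic => // [i j eij|].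
    by apply/ffunP => k; rewrite !ffunE !iterSr; apply: eP => //; apply/phiV/IV.
  by rewrite card_ffun !card_ord; apply: leq_trans C2; rewrite leq_exp2l.
have := eP _ _ eC v Vv; rewrite addnC => /eqP; rewrite -subr_eq0 -rmorphB /=.
by move=> /eqP/(@intr_Zp_eq0 6 _ isT).
Qed.

Lemma img_fix x : img C x -> iter C`! phi x = x.
Proof.
have itE j y : iter j (iter C`! phi) y = iter (j * C`!) phi y.
  by elim: j => //= j ->; rewrite mulSn iterD.
have imgC y : img C y -> img C (iter C`! phi y).
  move=> [v [Vv <-]]; rewrite -iterD addnC iterD.
  by exists (iter C`! phi v); split=> //; apply: iter_in.
(* The period of [iter C]! phi[on]img C[is taken to be]t[, as]t * C[!] is a multiple of [t]. *)
apply: (order_mod6 fr (img_subgroup C) (@imgF C) (iter_morphM _) imgC t0 _ add_on_mod6).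
by move=> _ [v [Vv <-]]; rewrite itE -iterD addnC mulnC periodic.
Qed.

Lemma period_fact : iter C phi =1 iter (C + C`!) phi.
Proof.
move=> x; set h := iter C phi x; set v := iter C phi (iter C`! phi x * x^-1).
have vE : v = iter C`! phi h * h^-1.
  by rewrite /v iter_morphM iter_morphV -!iterD addnC.
(* The cosets of the iterates of [x] have, from step [C] on, a period dividing the factorial of
   [C]. *)
have Vv : V v.
  rewrite vE -iterD; apply/clsE.
  rewrite addnC -[C`!]mul1n.
  apply: (@eventually_periodic _ (fun i => cls (iter i phi x))) => //.
    by move=> i j; apply: cls_step.
  by apply: leq_trans C1; apply: leq_addr.
have fv : iter C`! phi v = v by apply/img_fix/V_img.
have ph : iter C`! phi h = v * h by rewrite vE mulgVK.
have phj j : iter (j * C`!) phi h = v ^+ j * h.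
  elim: j => [|j IH]; first by rewrite expg0 mul1g.
  rewrite mulSn iterD IH iter_morphM ph mulgA expgSr; congr (_ * _ * _).
  by elim: (j) => [|i IHi]; rewrite ?iter_morph1 // !expgS iter_morphM fv IHi.
have : v ^+ t * h = h by rewrite -phj mulnC /h -iterD addnC periodic.
move/(canRL (mulgK _)); rewrite mulgV; case: t t0 => // t' _ /(free_torsion fr (VF Vv)) v1.
by rewrite addnC iterD -/h ph v1 mul1g.
Qed.

End Periodic.

Lemma finite_order_bound : 6 ^ (#|E| * #|X|) <= C ->
  (exists p q, p <> q /\ iter p phi =1 iter q phi) <->
  iter C phi =1 iter (C + C`!) phi.
Proof.
move=> C2; split=> [[p [q [pq e]]]|e]; last first.
  by exists C, (C + C`!)%N; split=> //; have := fact_gt0 C; lia.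
wlog lt : p q pq e / p < q.
  move=> W; case: (ltngtP p q) pq => // lt _.
    by apply: (W p q) => //; lia.
  by apply: (W q p) => //; lia.
have /preperiod pe : iter p phi =1 iter (p + (q - p)) phi by rewrite subnKC // ltnW.
by apply: (@period_fact C2 (q - p)) => //; rewrite subn_gt0.
Qed.

End Constant.
End Bound.

Lemma morph_weval (X : eqType) (G K : groupType) (g : X -> G) (s : G -> K) w :
  {morph s : x y / x * y} -> s (weval g w) = weval (s \o g) w.
Proof.
move=> sM; have s1 : s 1 = 1 by apply: (@mulgI _ (s 1)); rewrite -sM !mulg1.
have sV x : s x^-1 = (s x)^-1 by apply/esym/mulg1_eq; rewrite -sM mulgV.
elim: w => [|[a e] w IH]; first by rewrite !weval_nil.
by rewrite !weval_cons sM IH; congr (_ * _); case: e; rewrite /lval /= ?sV.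
Qed.

(** * The fully invariant subgroup of a decomposed group and its index *)

Section Decomposed.
Variables (D : vfdata) (G : groupType) (g : vfgen D -> G).
Hypothesis dec : vf_decomposition g.

Local Notation gA := (fun a => g (inl a)).

Lemma gA_free : freely gA.
Proof. exact: vf_free dec. Qed.

Lemma coset_index_exists x : exists i, gen_by gA (x * (g (inr i))^-1).
Proof.
have [i [f [Ff ->]]] := vf_cover dec x; exists i; rewrite mulgK; exact: Ff.
Qed.

Definition coset_index x := projT1 (cid (coset_index_exists x)).

Lemma coset_indexP x : gen_by gA (x * (g (inr (coset_index x)))^-1).
Proof. by rewrite /coset_index; case: cid. Qed.

Lemma coset_indexE x i : gen_by gA (x * (g (inr i))^-1) -> coset_index x = i.
Proof.
move=> Fi; apply: (vf_disjoint dec (coset_indexP x) Fi).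
by rewrite !mulgVK.
Qed.

Definition coset_act x i := coset_index (g (inr i) * x).

Lemma coset_actM x y i : coset_act (x * y) i = coset_act y (coset_act x i).
Proof.
apply: coset_indexE; set j := coset_act x i.
have := gen_byM (coset_indexP (g (inr i) * x)) (coset_indexP (g (inr j) * y)).
by rewrite -/(coset_act x i) -/j -/(coset_act y j) !mulgA mulgVK.
Qed.

Lemma coset_act1 i : coset_act 1 i = i.
Proof. by apply: coset_indexE; rewrite mulg1 mulgV; apply: gen_by1. Qed.

Lemma coset_actK x : cancel (coset_act x) (coset_act x^-1).
Proof. by move=> i; rewrite -coset_actM mulgV coset_act1. Qed.

Definition coset_perm x : 'S_(dm D) := perm (can_inj (@coset_actK x)).

Lemma coset_permM : {morph coset_perm : x y / x * y}.
Proof. by move=> x y; apply/permP => i; rewrite permM !permE coset_actM. Qed.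

(** The coset [F b_i] that contains 1 is fixed, and its [b_i] lies in F; hence so does [x]. *)
Lemma coset_perm_ker x : coset_perm x = 1 -> gen_by gA x.
Proof.
move=> /permP/(_ (coset_index 1)); rewrite permE perm1 /coset_act.
set i := coset_index 1; have Fb : gen_by gA (g (inr i)).
  rewrite -[g _]invgK; apply: gen_byV; rewrite -[_^-1]mul1g.
  exact: coset_indexP.
move=> e; have := coset_indexP (g (inr i) * x); rewrite e => Fx.
have -> : x = (g (inr i))^-1 * (g (inr i) * x * (g (inr i))^-1) * g (inr i).
  by rewrite !mulgA mulVg mul1g mulgVK.
by apply: gen_byM => //; apply: gen_byM => //; apply: gen_byV.
Qed.

Definition perm_kernel (x : G) := forall s : G -> 'S_(dm D),
  {morph s : x y / x * y} -> s x = 1.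

Lemma perm_kernel_subgroup : subgroup perm_kernel.
Proof.
have s1 (s : G -> 'S_(dm D)) : {morph s : x y / x * y} -> s 1 = 1.
  by move=> sM; apply: (@mulgI _ (s 1)); rewrite -sM !mulg1.
split=> [s sM|x y Vx Vy s sM|x Vx s sM]; first exact: s1.
  by rewrite sM Vx // Vy // mulg1.
by apply: (@mulgI _ (s x)); rewrite -sM mulgV Vx // mulg1 s1.
Qed.

Lemma perm_kernel_free x : perm_kernel x -> gen_by gA x.
Proof. by move/(_ _ coset_permM)/coset_perm_ker. Qed.

Lemma perm_kernel_stable (phi : G -> G) x : {morph phi : x y / x * y} ->
  perm_kernel x -> perm_kernel (phi x).
Proof.
by move=> phiM Vx s sM; apply: (Vx (s \o phi)) => y z; rewrite /= phiM sM.
Qed.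

Local Notation vals := {ffun ('I_(dA D) + 'I_(dm D))%type -> 'S_(dm D)}.

Definition extendable (k : vals) := exists s : G -> 'S_(dm D),
  {morph s : x y / x * y} /\ forall t, s (g t) = k t.

(** The values at [x] of all homomorphisms to S_m, indexed by their values on the generators; an
    assignment that does not extend contributes the constant 1. Only the size of this finite type
    enters the bounds. *)
Definition perm_class (x : G) : {ffun vals -> 'S_(dm D)} := [ffun k =>
  if pselect (extendable k) is left h then projT1 (cid h) x else 1].

Lemma perm_classE x y : perm_class x = perm_class y <-> perm_kernel (x * y^-1).
Proof.
have sd (s : G -> 'S_(dm D)) : {morph s : x y / x * y} ->
    s (x * y^-1) = 1 <-> s x = s y.
  move=> sM; split=> e; first by rewrite -(mulgVK y x) sM e mul1g.
  by apply: (@mulIg _ (s y)); rewrite -sM mulgVK mul1g.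
split=> [/ffunP e s sM|Vxy].
  apply/(sd s sM); have := e [ffun t => s (g t)]; rewrite !ffunE.
  case: pselect => [h|[]]; last by exists s; split=> // t; rewrite ffunE.
  case: cid => s' /= [sM' sE']; have [gen _] := vf_presented dec.
  have ss z : s' z = s z.
    have [w <-] := gen z; rewrite !(morph_weval _ (X := ('I_(dA D) + 'I_(dm D))%type)) //.
    apply: eq_bigr => -[a []] _ /=; by rewrite sE' ffunE.
  by rewrite !ss.
apply/ffunP => k; rewrite !ffunE; case: pselect => // h.
by case: cid => s [sM _] /=; apply/(sd s sM)/Vxy.
Qed.

Lemma card_perm_class : #|{ffun vals -> 'S_(dm D)}| = coset_bound (dA D) (dm D).
Proof. by rewrite !card_ffun card_sum !card_ord card_Sn. Qed.

Variable phi : {multiplicative G -> G}.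

Let C := order_bound (dA D) (dm D).

Let phiM : {morph phi : x y / x * y} := @gmulfM _ _ phi.

Lemma order_bound1 : #|{ffun vals -> 'S_(dm D)}| +
  #|{ffun vals -> 'S_(dm D)}| * #|'I_(dA D)| <= C.
Proof. by rewrite card_perm_class card_ord leq_addr. Qed.

Lemma order_bound2 : 6 ^ (#|{ffun vals -> 'S_(dm D)}| * #|'I_(dA D)|) <= C.
Proof. by rewrite card_perm_class card_ord leq_addl. Qed.

Lemma finite_orderE : finite_order phi <-> iter C phi =1 iter (C + C`!) phi.
Proof.
apply: (finite_order_bound gA_free perm_kernel_subgroup perm_kernel_free
  perm_classE phiM _ order_bound1 order_bound2).
by move=> x; apply: perm_kernel_stable.
Qed.

Lemma aperiodicE : aperiodic phi <-> iter C phi =1 iter C.+1 phi.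
Proof.
apply: (aperiodic_bound gA_free perm_kernel_subgroup perm_kernel_free
  perm_classE phiM _ order_bound1).
by move=> x; apply: perm_kernel_stable.
Qed.

End Decomposed.

Lemma nth_allpairs (S T R : Type) (f : S -> T -> R) x0 y0 z0 s t i j :
  i < size s -> j < size t ->
  nth z0 [seq f x y | x <- s, y <- t] (i * size t + j)%N = f (nth x0 s i) (nth y0 t j).
Proof.
elim: s i => //= x s IH [|i] si tj; rewrite nth_cat size_map.
  by rewrite mul0n add0n tj (nth_map y0).
by rewrite mulSn -addnA ltnNge leq_addr /= addKn IH.
Qed.

(** * Words coded by natural numbers *)

Definition letter_of (c : nat) : nat * bool := (c./2, odd c).

Lemma letter_of_inj : injective letter_of.
Proof. by move=> c c' [h o]; rewrite -[c]odd_double_half -[c']odd_double_half h o. Qed.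

Lemma letter_of_linvn c : letter_of (linvn c) = linv (letter_of c).
Proof.
rewrite /letter_of /linv /linvn /=; case o: (odd c) => /=; last first.
  by rewrite o uphalf_half o.
case: c o => //= c /negPf o.
by rewrite o uphalf_half o.
Qed.

Lemma letters_winvn w : map letter_of (winvn w) = winv (map letter_of w).
Proof.
rewrite /winvn /winv -!map_rev -map_comp -[w in LHS]revK foldl_rev.
elim: (rev w) => //= c v ->; congr (_ :: _); exact: letter_of_linvn.
Qed.

Lemma letters_pushn st w :
  map letter_of (foldl pushn st w) = foldl (@push nat) (map letter_of st) (map letter_of w).
Proof.
elim: w st => //= c w IH st; rewrite IH; congr foldl.
case: st => [|c' st] //=.
rewrite -letter_of_linvn (inj_eq letter_of_inj).
by case: ifP.
Qed.

Lemma weval_pushn (G : groupType) (h : nat -> G) st w :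
  weval h (rev (map letter_of (foldl pushn st w))) =
  weval h (rev (map letter_of st)) * weval h (map letter_of w).
Proof.
rewrite letters_pushn; elim: w (map letter_of st) => [|c w IH] t /=.
  by rewrite weval_nil mulg1.
rewrite IH weval_cons mulgA; congr (_ * _).
rewrite -[LHS]mul1g -weval_foldl foldl_push => [|x l]; last by rewrite lval_linv mulgK.
by rewrite weval_foldl mul1g.
Qed.

Definition letters_below n (w : seq nat) := all (fun c => c./2 < n) w.

Lemma below_pushn n st w : letters_below n st -> letters_below n w ->
  letters_below n (foldl pushn st w).
Proof.
elim: w st => //= c w IH st bst /andP[bc bw]; apply: IH => //.
case: st bst => [|c' st] /=; rewrite ?bc //= => /andP[bc' bst].
by case: ifP; rewrite //= bc bc'.
Qed.

Lemma below_winvn n w : letters_below n w -> letters_below n (winvn w).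
Proof.
have half_linvn c : (linvn c)./2 = c./2 by have [] := letter_of_linvn c.
rewrite /winvn; have: letters_below n [::] by [].
elim: w [::] => //= c w IH t bt /andP[bc bw]; apply: IH => //=.
by rewrite half_linvn bc.
Qed.

Lemma below_signed n c w : letters_below n w -> letters_below n (signed c w).
Proof. by rewrite /signed; case: ifP => // _; apply: below_winvn. Qed.

Lemma weval_signed (G : groupType) (h : nat -> G) c w :
  weval h (map letter_of (signed c w)) =
  if odd c then (weval h (map letter_of w))^-1 else weval h (map letter_of w).
Proof. by rewrite /signed; case: ifP => // _; rewrite letters_winvn weval_winv. Qed.

Definition coded (X : Type) (e : X -> nat) (w : word X) : seq nat :=
  [seq (e l.1).*2 + nat_of_bool l.2 | l : X * bool <- w].

Lemma letters_coded (X : Type) (e : X -> nat) w :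
  map letter_of (coded e w) = [seq (e l.1, l.2) | l : X * bool <- w].
Proof.
rewrite -map_comp; apply: eq_map => -[x b] /=.
by case: b; rewrite /letter_of ?addn1 ?addn0 /= ?uphalf_double ?doubleK odd_double.
Qed.

Lemma weval_coded (X : Type) (e : X -> nat) (G : groupType) (h : nat -> G) (k : X -> G) w :
  (forall x, h (e x) = k x) -> weval h (map letter_of (coded e w)) = weval k w.
Proof.
move=> hk; rewrite letters_coded /weval big_map.
by apply: eq_bigr => l _ /=; rewrite hk.
Qed.

Lemma below_coded (X : Type) (e : X -> nat) n w :
  (forall x, e x < n) -> letters_below n (coded e w).
Proof.
move=> en; rewrite /letters_below all_map; elim: w => //= -[x b] w ->.
by rewrite andbT; case: b; rewrite ?addn1 ?addn0 /= ?uphalf_double ?doubleK en.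
Qed.

Lemma coded_exists n st : letters_below n st -> exists u : word 'I_n, st = coded val u.
Proof.
elim: st => [|c st IH] /=; first by exists [::].
move=> /andP[bc /IH[u ->]]; exists ((Ordinal bc, odd c) :: u) => /=.
by rewrite addnC odd_double_half.
Qed.

Lemma reduced_coded n (u : word 'I_n) :
  reduced (map letter_of (coded val u)) = reduced u.
Proof.
rewrite letters_coded /reduced sorted_map; apply: eq_sorted => l l' /=.
by congr negb; rewrite !xpair_eqE.
Qed.

(** * Correctness of normal forms and of the comparison of powers *)

Section Correctness.
Variables (D : vfdata) (G : groupType) (g : vfgen D -> G).
Variables (img : vfgen D -> word (vfgen D)) (phi : {multiplicative G -> G}).
Hypothesis dec : vf_decomposition g.
Hypothesis phi_img : forall x, phi (g x) = weval g (img x).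

Local Notation gA := (fun a => g (inl a)).
Let s := CodeSeq.decode (code_input img).

Let phiM : {morph phi : x y / x * y} := @gmulfM _ _ phi.

Lemma input_A : nth 0 s 0 = dA D.
Proof. by rewrite /s CodeSeq.codeK. Qed.

Lemma input_m : nth 0 s 1 = dm D.
Proof. by rewrite /s CodeSeq.codeK. Qed.

Lemma tableuE (i : 'I_(dm D)) (a : 'I_(dA D)) :
  tableu s (i * dA D + a)%N = coded val (du i a).
Proof.
rewrite /tableu /s CodeSeq.codeK /= CodeSeq.codeK.
have := @nth_allpairs _ _ _ (fun i a => code_word val (du i a)) i a 0
  (enum 'I_(dm D)) (enum 'I_(dA D)) i a.
by rewrite !size_enum_ord !nth_ord_enum !ltn_ord => ->; rewrite // CodeSeq.codeK.
Qed.

Lemma tablevE (i j : 'I_(dm D)) : tablev s (i * dm D + j)%N = coded val (dv i j).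
Proof.
rewrite /tablev /s CodeSeq.codeK /= CodeSeq.codeK.
have := @nth_allpairs _ _ _ (fun i j => code_word val (dv i j)) i j 0
  (enum 'I_(dm D)) (enum 'I_(dm D)) i j.
by rewrite !size_enum_ord !nth_ord_enum !ltn_ord => ->; rewrite // CodeSeq.codeK.
Qed.

Lemma tablerE (i j : 'I_(dm D)) : tabler s (i * dm D + j)%N = dr i j.
Proof.
rewrite /tabler /s CodeSeq.codeK /= CodeSeq.codeK.
have := @nth_allpairs _ _ _ (fun i j => val (dr i j)) i j 0
  (enum 'I_(dm D)) (enum 'I_(dm D)) i j.
by rewrite !size_enum_ord !nth_ord_enum !ltn_ord => ->.
Qed.

Lemma tableiE (x : vfgen D) : tablei s (code_gen x) = coded (@code_gen D) (img x).
Proof.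
rewrite /tablei input_A; case: x => [a|i] /=.
  rewrite ltn_ord /s CodeSeq.codeK /= CodeSeq.codeK.
  by rewrite (nth_map a) ?size_enum_ord // nth_ord_enum CodeSeq.codeK.
rewrite ltnNge leq_addr /= addKn /s CodeSeq.codeK /= CodeSeq.codeK.
by rewrite (nth_map i) ?size_enum_ord // nth_ord_enum CodeSeq.codeK.
Qed.

Lemma code_gen_inj : injective (@code_gen D).
Proof.
move=> [a|i] [b|j] /=; try by [move/val_inj-> | move/addnI/val_inj->].
  by move=> e; have := ltn_ord a; rewrite e ltnNge leq_addr.
by move=> e; have := ltn_ord b; rewrite -e ltnNge leq_addr.
Qed.

Lemma code_gen_lt (x : vfgen D) : code_gen x < dA D + dm D.
Proof. by case: x => [a|i] /=; rewrite ?ltn_add2l // ltn_addr. Qed.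

Lemma code_gen_onto t : t < dA D + dm D -> exists x : vfgen D, code_gen x = t.
Proof.
move=> lt; case: (ltnP t (dA D)) => [ta|ta]; first by exists (inl (Ordinal ta)).
have ti : t - dA D < dm D by rewrite ltn_subLR.
by exists (inr (Ordinal ti)); rewrite /= subnKC.
Qed.

Definition gen_of (t : nat) : G :=
  if [pick x : 'I_(dA D) + 'I_(dm D) | code_gen (x : vfgen D) == t] is Some x
  then g x else 1.

Lemma gen_ofE (x : vfgen D) : gen_of (code_gen x) = g x.
Proof.
rewrite /gen_of; case: pickP => [y /eqP/code_gen_inj-> //|/(_ x)].
by rewrite eqxx.
Qed.

Definition ev (w : seq nat) : G := weval gen_of (map letter_of w).

Lemma ev_cat w w' : ev (w ++ w') = ev w * ev w'.
Proof. by rewrite /ev map_cat weval_cat. Qed.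

Lemma ev_coded w : ev (coded (@code_gen D) w) = weval g w.
Proof. by apply: weval_coded => x; rewrite gen_ofE. Qed.

Lemma ev_codedA (w : word 'I_(dA D)) : ev (coded val w) = weval gA w.
Proof. by apply: weval_coded => a; rewrite (gen_ofE (inl a)). Qed.

Lemma weval_wordA (w : word 'I_(dA D)) : weval g (wordA w) = weval gA w.
Proof. by rewrite /weval big_map. Qed.

Lemma rel_conj i a : g (inr i) * g (inl a) = weval gA (du i a) * g (inr i).
Proof.
have [_ /(_ _ _)/iffRL/(_ (WC_rel (VFR_conj i a)))] := vf_presented dec.
by rewrite weval_cat !weval_cons !weval_nil !mulg1 weval_wordA.
Qed.

Lemma rel_mul i j : g (inr i) * g (inr j) = weval gA (dv i j) * g (inr (dr i j)).
Proof.
have [_ /(_ _ _)/iffRL/(_ (WC_rel (VFR_mul i j)))] := vf_presented dec.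
by rewrite weval_cat !weval_cons !weval_nil !mulg1 weval_wordA.
Qed.

(** Take for [k] the coset of [b_i b_j^-1]: then [b_k b_j] lies in [F b_i], and disjointness
    identifies the index. *)
Lemma dr_onto (i j : 'I_(dm D)) : exists k, dr k j = i.
Proof.
have [k [f [Ff e]]] := vf_cover dec (g (inr i) * (g (inr j))^-1); exists k.
have bi : g (inr i) = f * weval gA (dv k j) * g (inr (dr k j)).
  by rewrite -mulgA -rel_mul mulgA -e mulgVK.
apply: (@vf_disjoint _ _ _ dec (dr k j) i (f * weval gA (dv k j)) 1).
- by apply: gen_byM => //; exists (dv k j).
- exact: gen_by1.
- by rewrite mul1g.
Qed.

Lemma invrE (i j : 'I_(dm D)) : exists k : 'I_(dm D), invr s i j = k /\ dr k j = i.
Proof.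
have [k0 k0E] := dr_onto i j; rewrite /invr input_m.
suff H n : n <= dm D -> (exists k : 'I_(dm D), k < n /\ dr k j = i) ->
    exists k : 'I_(dm D), nat_rect (fun=> nat) 0 (fun k y =>
      if tabler s (k * dm D + j) == i then k else y) n = k /\ dr k j = i.
  by apply: H => //; exists k0.
elim: n => [|n IH] ln [k [kn kE]] //=.
have := tablerE (Ordinal ln) j; rewrite /= => ->.
case: eqP => [/val_inj e|ne]; first by exists (Ordinal ln).
apply: IH (ltnW ln) _; exists k; split=> //.
move: kn; rewrite ltnS leq_eqVlt => /predU1P[e|//]; case: ne.
by rewrite -kE; congr (nat_of_ord (dr _ _)); apply: val_inj.
Qed.

Definition state_ok (x : seq nat * nat) :=
  [/\ letters_below (dA D) x.1, reduced (map letter_of x.1) & x.2 < dm D].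

Definition state_val (x : seq nat * nat) : G :=
  weval gen_of (rev (map letter_of x.1)) * gen_of (dA D + x.2).

Lemma gen_of_inr (i : 'I_(dm D)) : gen_of (dA D + i) = g (inr i).
Proof. exact: (gen_ofE (inr i)). Qed.

Lemma reduced_pushw st w : reduced (map letter_of st) ->
  reduced (map letter_of (foldl pushn st w)).
Proof.
rewrite letters_pushn; elim: (map letter_of w) (map letter_of st) => //= l v IH t rt.
by apply/IH/reduced_push.
Qed.

Lemma gstepP x c : state_ok x -> c./2 < dA D + dm D ->
  state_ok (gstep s x c) /\ state_val (gstep s x c) = state_val x * ev [:: c].
Proof.
case: x => st i [/= bst rst ilt] /code_gen_onto[y yE].
pose i' := Ordinal ilt; have evc : ev [:: c] = if odd c then (g y)^-1 else g y.
  by rewrite /ev /weval big_seq1 /= -yE gen_ofE.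
have coded_ok (w : word 'I_(dA D)) : letters_below (dA D) (coded val w).
  by apply: below_coded => a; apply: ltn_ord.
rewrite evc /gstep /state_val input_A input_m -yE [(st, i).1]/= [(st, i).2]/=.
case: y yE evc => [a|j] /= yE _; rewrite ?ltn_ord; last rewrite ltnNge leq_addr /= addKn.
  have := tableuE i' a; rewrite /= => ->; split.
    split=> //=; last exact: reduced_pushw.
    by apply: below_pushn => //; apply: below_signed.
  rewrite weval_pushn weval_signed -/(ev _) ev_codedA -!mulgA; congr (_ * _).
  rewrite (gen_of_inr i'); case: ifP => _; last by rewrite rel_conj.
  by apply: (@mulgI _ (weval gA (du i' a))); rewrite mulVKg mulgA -rel_conj mulgK.
case o: (odd c); last first.
  have := tablevE i' j; have := tablerE i' j; rewrite /= => -> ->; split.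
    by split=> //=; [apply: below_pushn|apply: reduced_pushw].
  by rewrite weval_pushn -/(ev _) ev_codedA -!mulgA (gen_of_inr i') gen_of_inr rel_mul.
have [k [kE krE]] := invrE i' j; rewrite /= in kE; rewrite kE.
have := tablevE k j; rewrite /= => ->; split.
  by split=> //=; [apply: below_pushn => //; apply: below_winvn|apply: reduced_pushw].
rewrite weval_pushn letters_winvn weval_winv -/(ev _) ev_codedA -!mulgA; congr (_ * _).
rewrite (gen_of_inr i') gen_of_inr; apply: (@mulgI _ (weval gA (dv k j))).
by rewrite mulVKg mulgA; apply: (@mulIg _ (g (inr j))); rewrite mulgVK rel_mul krE.
Qed.

Lemma normP w : letters_below (dA D + dm D) w ->
  state_ok (norm s w) /\ state_val (norm s w) = gen_of (dA D + 0) * ev w.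
Proof.
(* The coset of 1 shows that [dm D] is positive, so index 0 of the initial state is legitimate. *)
have [i0 _] := vf_cover dec 1.
elim/last_ind: w => [_|w c IH].
  split; first by split=> //=; apply: leq_ltn_trans (ltn_ord i0).
  by rewrite /state_val /ev /= !weval_nil mulg1 mul1g.
rewrite /letters_below all_rcons => /andP[bc bw]; have [ok e] := IH bw.
have [ok' e'] := gstepP ok bc; rewrite /norm foldl_rcons -/(norm s w).
by split=> //; rewrite e' e -cats1 ev_cat mulgA.
Qed.

(** Disjointness of the cosets gives equal indices; after cancelling [b_i], freeness of F gives
    equal reduced words. *)
Lemma state_val_inj x y : state_ok x -> state_ok y -> state_val x = state_val y -> x = y.
Proof.
case: x y => [st i] [st' i'] [/= b r li] [/= b' r' li'].
have [u uE] := coded_exists b; have [u' uE'] := coded_exists b'.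
rewrite /state_val /= (gen_of_inr (Ordinal li)) (gen_of_inr (Ordinal li')).
have codE (v : word 'I_(dA D)) :
    weval gen_of (rev (map letter_of (coded val v))) = weval gA (rev v).
  rewrite letters_coded -map_rev /weval big_map; apply: eq_bigr => -[a e] _ /=.
  by rewrite (gen_ofE (inl a)).
rewrite {}uE {}uE' !codE in r r' *; rewrite !reduced_coded in r r' => e.
have Fw v : in_F g (weval gA v) by exists v.
have [ei] := vf_disjoint dec (Fw _) (Fw _) e.
have eO : Ordinal li = Ordinal li' by apply: val_inj.
move: e; rewrite eO => /mulIg/(vf_free dec) e; congr (_, _) => //.
by congr coded; apply: (can_inj revK); apply: e; rewrite reduced_rev.
Qed.

Lemma substP w : letters_below (dA D + dm D) w ->
  letters_below (dA D + dm D) (subst s w) /\ ev (subst s w) = phi (ev w).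
Proof.
have phi1 : phi 1 = 1 by apply: (@mulgI _ (phi 1)); rewrite -phiM !mulg1.
have phiV x : phi x^-1 = (phi x)^-1.
  by apply/esym/mulg1_eq; rewrite -phiM mulgV.
elim/last_ind: w => [_|w c IH]; first by rewrite /ev weval_nil phi1.
rewrite /letters_below all_rcons => /andP[bc bw]; have [ok e] := IH bw.
rewrite /subst foldl_rcons -/(subst s w) -cats1 !ev_cat phiM e.
have [y yE] := code_gen_onto bc; rewrite -yE tableiE; split.
  rewrite /letters_below all_cat [X in X && _]ok; apply: below_signed.
  exact/below_coded/code_gen_lt.
congr (_ * _); rewrite {1}/ev weval_signed -/(ev _) ev_coded -phi_img.
rewrite /ev /weval big_seq1 /= -yE gen_ofE.
by case: ifP.
Qed.

Lemma iter_substP n w : letters_below (dA D + dm D) w ->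
  letters_below (dA D + dm D) (iter n (subst s) w) /\
  ev (iter n (subst s) w) = iter n phi (ev w).
Proof.
move=> bw; elim: n => //= n [IHb IHe]; have [b e] := substP IHb.
by rewrite e IHe.
Qed.

Lemma enc_state_inj : injective (fun x : seq nat * nat => enc x).
Proof.
move=> [st i] [st' i'] e; have e1 := congr1 cfst e; have e2 := congr1 csnd e.
rewrite !cfstE !csndE /enc /enc_seq !map_id in e1 e2.
by move: e1 e2 => /= /(can_inj CodeSeq.codeK) -> e2; congr (_, _); exact: e2.
Qed.

Lemma same_powerP n1 n2 : same_power s n1 n2 <-> iter n1 phi =1 iter n2 phi.
Proof.
have key t : t < dA D + dm D ->
    enc (norm s (iter n1 (subst s) [:: t.*2])) == enc (norm s (iter n2 (subst s) [:: t.*2]))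
    <-> iter n1 phi (gen_of t) = iter n2 phi (gen_of t).
  move=> lt; have bt : letters_below (dA D + dm D) [:: t.*2] by rewrite /= doubleK lt.
  have et : ev [:: t.*2] = gen_of t by rewrite /ev /weval big_seq1 /= odd_double doubleK.
  have [b1 e1] := iter_substP n1 bt; have [b2 e2] := iter_substP n2 bt.
  have [ok1 v1] := normP b1; have [ok2 v2] := normP b2; rewrite -et -e1 -e2.
  split=> [/eqP/enc_state_inj e|e].
    by apply: (@mulgI _ (gen_of (dA D + 0))); rewrite -v1 -v2 e.
  by apply/eqP; congr enc; apply: state_val_inj => //; rewrite v1 v2 e.
have iM n : {morph iter n phi : x y / x * y} by apply: (iter_morphM phiM n).
have all_t : same_power s n1 n2 <-> forall t, t < dA D + dm D ->
    iter n1 phi (gen_of t) = iter n2 phi (gen_of t).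
  rewrite /same_power input_A input_m.
  have: dA D + dm D <= dA D + dm D by [].
  elim: {-2}(dA D + dm D)%N => [|n IH] ln /=; first by split.
  split.
    move=> /andP[/(IH (ltnW ln)) h /(key n ln) hn] t; rewrite ltnS leq_eqVlt.
    by case/predU1P => [->|/h].
  move=> h; apply/andP; split; last by apply/(key n ln)/h.
  by apply/(IH (ltnW ln)) => t tn; apply: h; apply: ltnW.
split=> [/all_t h x|e]; last by apply/all_t => t _; apply: e.
have [gen _] := vf_presented dec; have [w <-] := gen x.
rewrite !(morph_weval _ (X := ('I_(dA D) + 'I_(dm D))%type)) //.
apply: eq_bigr => -[y b] _ /=.
by rewrite -gen_ofE h ?code_gen_lt.
Qed.

Lemma input_boundE : input_bound s = order_bound (dA D) (dm D).
Proof. by rewrite /input_bound input_A input_m. Qed.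

End Correctness.

Lemma decides_bool (f : nat -> bool) M x P :
  (forall a, computes M [:: enc a] (enc (f a))) -> (f x <-> P) -> decides M x P.
Proof.
move=> Mf fP; split=> [/fP fx|nP]; have := Mf x; first by rewrite fx.
by have -> : f x = false by apply/negP => /fP.
Qed.

Theorem corollary5p8 :
  (exists M : recfun,
    forall (D : vfdata) (G : groupType) (g : vfgen D -> G)
           (img : vfgen D -> word (vfgen D)) (phi : {multiplicative G -> G}),
      vf_decomposition g ->
      (forall x : vfgen D, phi (g x) = weval g (img x)) ->
      decides M (code_input img) (finite_order phi))
  /\
  (exists M : recfun,
    forall (D : vfdata) (G : groupType) (g : vfgen D -> G)
           (img : vfgen D -> word (vfgen D)) (phi : {multiplicative G -> G}),
      vf_decomposition g ->
      (forall x : vfgen D, phi (g x) = weval g (img x)) ->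
      decides M (code_input img) (aperiodic phi)).
Proof.
have [M ME] := computable_finite_order; have [N NE] := computable_aperiodic.
split; [exists M|exists N] => D G g img phi dec phi_img.
  apply: (decides_bool ME); rewrite (same_powerP dec phi_img) input_boundE.
  by rewrite (finite_orderE dec).
apply: (decides_bool NE); rewrite (same_powerP dec phi_img) input_boundE.
by rewrite (aperiodicE dec).
Qed.
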